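(* Let $T_0$ be any (seed) triangulation of a convex $(n+3)$-gon and let $\alpha_1,\dots,\alpha_n$ be a basis of an $n$-dimensional real vector space $V$. Then the complete simplicial fan $\mathcal F_{T_0}$ in $V$, whose maximal cones are the cones $\mathbb R_{\ge0}T$ for all triangulations $T$ of the $(n+3)$-gon, is the normal fan of an $n$-dimensional associahedron.
   Context: A diagonal of a convex polygon means an internal diagonal; two diagonals cross if they meet in a point interior to both. A triangulation of a convex $(n+3)$-gon (without new vertices) is identified with its set of $n$ pairwise non-crossing diagonals. Write $T_0=\{\delta_1,\dots,\delta_n\}$. To each diagonal $pq$ of the $(n+3)$-gon associate a vector $v_{pq}\in V$: if $pq=\delta_i$ for some $i$, then $v_{pq}=-\alpha_i$; if $pq\notin T_0$, then $v_{pq}=\sum_{i:\ pq\text{ crosses }\delta_i}\alpha_i$. For a triangulation $T$, $\mathbb R_{\ge0}T$ denotes the cone generated by the vectors $\{v_\delta:\delta\in T\}$. These cones and their faces form a complete simplicial fan in $V$, denoted $\mathcal F_{T_0}$. An $n$-dimensional associahedron is an $n$-dimensional simple polytope whose poset of non-empty faces is isomorphic to the poset of non-crossing sets of diagonals of a convex $(n+3)$-gon, ordered by reverse inclusion. The normal fan of a polytope in $V^*$ is the fan in $V$ consisting of the (outer) normal cones of its faces. *)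

(* Defs.v *)
From HB Require Import structures.
From mathcomp Require Import all_boot all_order all_algebra.
From mathcomp Require Import boolp classical_sets functions cardinality reals.

Set Implicit Arguments.
Unset Strict Implicit.
Unset Printing Implicit Defensive.

Import Order.TTheory GRing.Theory Num.Theory.

Local Open Scope classical_set_scope.
Local Open Scope ring_scope.

(** * Polygons, diagonals, triangulations *)

(* Positive iff a, b, c make a left (counterclockwise) turn. *)
Definition orient (R : realType) (a b c : 'rV[R]_2) : R :=
  (b 0 0 - a 0 0) * (c 0 1 - a 0 1) - (b 0 1 - a 0 1) * (c 0 0 - a 0 0).

(* x lists the vertices of a convex polygon in counterclockwise order: all the
   other vertices lie strictly to the left of each side x_i x_(i+1), where ordS
   is the cyclic successor. *)
Definition convex_polygon (R : realType) (n : nat) (x : 'I_n.+3 -> 'rV[R]_2) :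
    Prop :=
  forall i k : 'I_n.+3, k != i -> k != ordS i ->
    0 < orient (x i) (x (ordS i)) (x k).

(* A diagonal joins two non-adjacent vertices p, q; the unordered pair {p, q} is
   represented by (p, q) with p < q. By convexity it is internal. *)
Definition polygon_diagonal (n : nat) : finType :=
  {pq : 'I_n.+3 * 'I_n.+3
  | [&& (pq.1 < pq.2)%N, pq.2 != ordS pq.1 & pq.1 != ordS pq.2]}.

Definition diagonal_interior (R : realType) (n : nat) (x : 'I_n.+3 -> 'rV[R]_2)
    (D : polygon_diagonal n) : set 'rV[R]_2 :=
  [set z | exists2 t : R, 0 < t < 1 &
     z = (1 - t) *: x (val D).1 + t *: x (val D).2].

Definition crosses (R : realType) (n : nat) (x : 'I_n.+3 -> 'rV[R]_2)
    (D E : polygon_diagonal n) : Prop :=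
  D <> E /\ diagonal_interior x D `&` diagonal_interior x E !=set0.

Definition noncrossing (R : realType) (n : nat) (x : 'I_n.+3 -> 'rV[R]_2)
    (A : {set polygon_diagonal n}) : Prop :=
  forall D E, D \in A -> E \in A -> ~ crosses x D E.

Definition triangulation (R : realType) (n : nat) (x : 'I_n.+3 -> 'rV[R]_2)
    (T : {set polygon_diagonal n}) : Prop :=
  noncrossing x T /\ #|T| = n.

(** * Faces, cones and fans *)

(* Non-empty faces of a polyhedral cone or of a polytope: the non-empty
   intersections with supporting hyperplanes, the whole set included (f = 0). *)
Definition face (R : realType) (W : vectType R) (P F : set W) : Prop :=
  F !=set0 /\
  exists (f : 'Hom(W, R^o)) (b : R),
    (forall w, P w -> (f w : R) <= b) /\ F = [set w | P w /\ f w = b].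

Definition cone (R : realType) (W : vectType R) (s : seq W) : set W :=
  [set w | exists2 c : 'I_(size s) -> R,
     (forall i, 0 <= c i) & w = \sum_(i < size s) c i *: s`_i].

Definition is_fan (R : realType) (W : vectType R) (F : set (set W)) : Prop :=
  [/\ finite_set F,
      forall C, F C -> exists s, C = cone s,
      forall C D, F C -> face C D -> F D
    & forall C D, F C -> F D -> face C (C `&` D) /\ face D (C `&` D)].

Definition complete_fan (R : realType) (W : vectType R) (F : set (set W)) :
    Prop :=
  is_fan F /\ \bigcup_(C in F) C = setT.

Definition simplicial (R : realType) (W : vectType R) (F : set (set W)) : Prop :=
  forall C, F C -> exists2 s, free s & C = cone s.

Definition maximal_cones (R : realType) (W : vectType R) (F : set (set W)) :
    set (set W) :=
  [set C | F C /\ forall D, F D -> C `<=` D -> D = C].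

(** * Polytopes *)

Definition convex_hull (R : realType) (W : vectType R) (s : seq W) : set W :=
  [set w | exists c : 'I_(size s) -> R,
     [/\ forall i, 0 <= c i, \sum_(i < size s) c i = 1
       & w = \sum_(i < size s) c i *: s`_i]].

Definition polytope (R : realType) (W : vectType R) (P : set W) : Prop :=
  P !=set0 /\ exists s, P = convex_hull s.

(* For P non-empty: the affine hull of P has dimension d, its direction being
   the smallest subspace that contains all the differences of points of P. *)
Definition has_dim (R : realType) (W : vectType R) (P : set W) (d : nat) : Prop :=
  exists U : {vspace W},
    [/\ \dim U = d,
        forall a b, P a -> P b -> a - b \in U
      & forall U' : {vspace W},
          (forall a b, P a -> P b -> a - b \in U') -> (U <= U')%VS].

Definition vertex (R : realType) (W : vectType R) (P : set W) (v : W) : Prop :=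
  face P [set v].

Definition facet (R : realType) (W : vectType R) (P F : set W) : Prop :=
  face P F /\ exists d, has_dim P d.+1 /\ has_dim F d.

Definition simple_polytope (R : realType) (W : vectType R) (P : set W) : Prop :=
  polytope P /\
  forall d, has_dim P d -> forall v, vertex P v ->
    ([set F | facet P F /\ F v] #= `I_d)%card.

Definition associahedron (R : realType) (n : nat) (x : 'I_n.+3 -> 'rV[R]_2)
    (W : vectType R) (P : set W) : Prop :=
  [/\ simple_polytope P, has_dim P n
    & exists2 phi : {set polygon_diagonal n} -> set W,
        set_bij [set A | noncrossing x A] [set F | face P F] phi &
        forall A B, noncrossing x A -> noncrossing x B ->
          (phi A `<=` phi B <-> B \subset A)].

(* Outer normal cone in V of a face F of a polytope P in the dual space of V:
   the vectors u such that evaluation at u is maximized over P on all of F. *)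
Definition normal_cone (R : realType) (V : vectType R)
    (P F : set 'Hom(V, R^o)) : set V :=
  [set u | forall f g, F f -> P g -> (g u : R) <= f u].

Definition normal_fan (R : realType) (V : vectType R) (P : set 'Hom(V, R^o)) :
    set (set V) :=
  [set normal_cone P F | F in [set F | face P F]].

(** * The fan of a seed triangulation *)

Definition diag_vector (R : realType) (n : nat) (x : 'I_n.+3 -> 'rV[R]_2)
    (delta : 'I_n -> polygon_diagonal n) (V : vectType R) (alpha : n.-tuple V)
    (D : polygon_diagonal n) : V :=
  if [pick i | delta i == D] is Some i then - alpha`_i
  else \sum_(i < n | `[< crosses x D (delta i) >]) alpha`_i.

Definition triangulation_cone (R : realType) (n : nat)
    (x : 'I_n.+3 -> 'rV[R]_2) (delta : 'I_n -> polygon_diagonal n) (V : vectType R)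
    (alpha : n.-tuple V) (T : {set polygon_diagonal n}) : set V :=
  cone [seq diag_vector x delta alpha D | D <- enum T].

Definition seed_fan (R : realType) (n : nat) (x : 'I_n.+3 -> 'rV[R]_2)
    (delta : 'I_n -> polygon_diagonal n) (V : vectType R) (alpha : n.-tuple V) :
    set (set V) :=
  [set C | exists2 T, triangulation x T &
     face (triangulation_cone x delta alpha T) C].

(* Main.v *)
(* Let c_pq be the vector of crossings of the chord pq with T_0.  For a convex
   quadrilateral a < b < c < d the vectors of its two diagonals satisfy a positive
   relation l v_ac + m v_bd = (sum of some of c_ab, c_bc, c_cd, c_ad), of six
   possible shapes, where c_pq is either v_pq or 0.  The heights
   om_pq = |pq| (N - |pq|), doubled on T_0, make every relation strict:
   l om_ac + m om_bd exceeds the corresponding sum of heights of sides.  Hence a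
   linear form f with f(v_D) <= om_D for all D is tight only on a non-crossing set.

   Conversely each triangulation T carries a (unique) such form f_T, tight exactly
   on T: this is clear for T_0, and a flip of T amounts to walking from f_T along
   the edge that relaxes one tight constraint, the relation showing that the flipped
   diagonal is the next constraint met; flips connect all triangulations.  The
   polytope is the convex hull of the f_T.  A triangulation maximising f_T(u) has u
   in its cone, which gives completeness, and the faces are the loci
   {f(v_D) = om_D for D in A} for A non-crossing, with normal cone generated by
   {v_D : D in A}. *)
From HB Require Import structures.
Require Import Defs.
From mathcomp Require Import all_boot all_order all_algebra.
From mathcomp Require Import boolp classical_sets functions cardinality reals.
From mathcomp Require Import zify ring lra.

Set Implicit Arguments.
Unset Strict Implicit.
Unset Printing Implicit Defensive.

Import Order.TTheory GRing.Theory Num.Theory.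
Local Open Scope classical_set_scope.
Local Open Scope ring_scope.

(** * Convex position and crossings *)

Section Geometry.
Variables (R : realType) (n : nat) (x : 'I_n.+3 -> 'rV[R]_2).
Hypothesis x_convex : convex_polygon x.

Lemma orient_rot (a b c : 'rV[R]_2) : orient a b c = orient b c a.
Proof. by rewrite /orient; ring. Qed.

Lemma orient_swap (a b c : 'rV[R]_2) : orient a c b = - orient a b c.
Proof. by rewrite /orient; ring. Qed.

Lemma orient_lin (a b p q : 'rV[R]_2) (t : R) :
  orient a b ((1 - t) *: p + t *: q)
  = (1 - t) * orient a b p + t * orient a b q.
Proof. by rewrite /orient !mxE; ring. Qed.

Lemma orient_aab (a b : 'rV[R]_2) : orient a b a = 0.
Proof. by rewrite /orient; ring. Qed.

Lemma orient_abb (a b : 'rV[R]_2) : orient a b b = 0.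
Proof. by rewrite /orient; ring. Qed.

(* Seen from x_i, the other vertices lie in the half-plane to the left of the
   side x_i x_(i+1), where turning left is a transitive relation by the Pluecker
   relation among four vectors of the plane. *)
Lemma orient_pos (i j k : 'I_n.+3) : (i < j < k)%N -> 0 < orient (x i) (x j) (x k).
Proof.
have ordS_lt (a b : 'I_n.+3) : (a < b)%N -> ordS a = a.+1 :> nat.
  by move=> ab; rewrite /= modn_small // (leq_trans _ (ltn_ord b)).
have ordS_lt' (a : 'I_n.+3) : (a.+1 < n.+3)%N -> nat_of_ord (ordS a) = a.+1.
  by move=> h; rewrite /= modn_small.
case/andP=> ij jk.
have iS := ordS_lt _ _ ij.
have first (m : 'I_n.+3) : (i.+1 < m)%N -> 0 < orient (x i) (x (ordS i)) (x m).
  by move=> im; apply: x_convex; apply: contraTneq im => ->; rewrite -leqNgt ?iS ?leqnSn.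
have consec (m m' : 'I_n.+3) : (i < m)%N -> m' = m.+1 :> nat ->
    0 < orient (x i) (x m) (x m').
  move=> im mm'; have mS : ordS m = m' by apply: ord_inj; rewrite mm'; apply: ordS_lt'; rewrite -mm'.
  rewrite orient_rot -mS; apply: x_convex; rewrite -val_eqE ?mS /=; lia.
have [js|js] := eqVneq (nat_of_ord j) i.+1.
  have -> : j = ordS i by apply: ord_inj; rewrite iS.
  by apply: first; rewrite -js.
have {js}js : (i.+1 < j)%N by lia.
have [m Em] : exists m, nat_of_ord k = (j + m.+1)%N by exists (k - j).-1; lia.
elim: m k {jk} Em => [|m IH] k Em; first by apply: consec; rewrite ?Em //; lia.
have lt_m : (j + m.+1 < n.+3)%N by move: (ltn_ord k); lia.
pose k' := Ordinal lt_m.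
have h1 := IH k' erefl.
have h2 : 0 < orient (x i) (x k') (x k) by apply: consec; rewrite /= ?Em; lia.
have h3 : 0 < orient (x i) (x (ordS i)) (x j) by exact: first.
have h4 : 0 < orient (x i) (x (ordS i)) (x k') by apply: first => /=; lia.
have h5 : 0 < orient (x i) (x (ordS i)) (x k) by apply: first => /=; lia.
rewrite -(pmulr_rgt0 _ h4).
have -> : orient (x i) (x (ordS i)) (x k') * orient (x i) (x j) (x k) =
   orient (x i) (x (ordS i)) (x j) * orient (x i) (x k') (x k) +
   orient (x i) (x (ordS i)) (x k) * orient (x i) (x j) (x k').
  by rewrite /orient; ring.
by rewrite addr_gt0 // mulr_gt0.
Qed.

End Geometry.

Section Chords.
Variable n : nat.
Implicit Types D E G : polygon_diagonal n.

Definition fst_end D : nat := (val D).1.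
Definition snd_end D : nat := (val D).2.

Definition crossn (a b c d : nat) : bool :=
  [|| [&& a < c, c < b & b < d] | [&& c < a, a < d & d < b]]%N.

Definition crossb D E : bool :=
  crossn (fst_end D) (snd_end D) (fst_end E) (snd_end E).

Definition diagn (a b : nat) : bool :=
  [&& a.+1 < b, b < n.+3 & (0 < a) || (b < n.+2)]%N.

Lemma diagnP D : diagn (fst_end D) (snd_end D).
Proof.
case: D => -[p q] D; rewrite /diagn /fst_end /snd_end /=.
have /and3P[/= pq] := D; rewrite -!val_eqE /=; have := ltn_ord p; have := ltn_ord q.
move=> qn pn h1 h2.
rewrite modn_small in h1; last by lia.
have [qe|qe] := eqVneq (nat_of_ord q) n.+2; last by rewrite modn_small in h2; lia.
by rewrite qe modnn in h2; lia.
Qed.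

Lemma diagn_ex a b : diagn a b -> exists2 D, fst_end D = a & snd_end D = b.
Proof.
case/and3P=> ab bn h.
have an : (a < n.+3)%N by lia.
have H : [&& (Ordinal an < Ordinal bn)%N, Ordinal bn != ordS (Ordinal an)
         & Ordinal an != ordS (Ordinal bn)].
  rewrite -!val_eqE /= modn_small; last by lia.
  have [qe|qe] := eqVneq b n.+2; first by subst b; rewrite modnn; lia.
  by rewrite modn_small; lia.
by exists (exist _ (Ordinal an, Ordinal bn) H).
Qed.

Lemma diag_inj D E : fst_end D = fst_end E -> snd_end D = snd_end E -> D = E.
Proof.
case: D E => -[p q] Dp [[p' q'] Dp']; rewrite /fst_end /snd_end /= => h1 h2.
by apply/val_inj => /=; congr pair; apply/val_inj.
Qed.

Lemma diag_lt D : (fst_end D < snd_end D)%N.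
Proof. by have /and3P[] := diagnP D; lia. Qed.

Lemma crossbC D E : crossb D E = crossb E D.
Proof. by rewrite /crossb /crossn orbC. Qed.

Lemma crossbb D : crossb D D = false.
Proof. by rewrite /crossb /crossn ltnn. Qed.

Lemma crossn_inl p q r s : (p < r < q)%N -> ((s < p) || (q < s))%N -> (r < s)%N ->
  crossn p q r s.
Proof. by rewrite /crossn; lia. Qed.

Lemma crossn_inr p q r s : ((r < p) || (q < r))%N -> (p < s < q)%N -> (r < s)%N ->
  crossn p q r s.
Proof. by rewrite /crossn; lia. Qed.

Lemma crossesP (R : realType) (x : 'I_n.+3 -> 'rV[R]_2) :
  convex_polygon x -> forall D E, crosses x D E <-> crossb D E.
Proof.
move=> cx D E.
have opos := @orient_pos R n x cx.
case: D E => -[p q] pD [[r s] pE].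
have /and3P[/= pq _ _] := pD; have /and3P[/= rs _ _] := pE.
rewrite /crossb /fst_end /snd_end /=.
have oneg (i j k : 'I_n.+3) : (i < k < j)%N -> orient (x i) (x j) (x k) < 0.
  by move=> h; rewrite orient_swap oppr_lt0; apply: opos.
have opos2 (i j k : 'I_n.+3) : (k < i < j)%N -> 0 < orient (x i) (x j) (x k).
  by move=> h; rewrite -orient_rot; apply: opos.
split; last first.
  move=> cr; split.
    by case=> pr qs; move: cr; rewrite pr qs /crossn ltnn.
  have key (a b c d : 'rV[R]_2) :
      0 < - orient a b c -> 0 < orient a b d ->
      0 < orient c d a -> 0 < - orient c d b ->
      exists z, (exists2 t : R, 0 < t < 1 & z = (1 - t) *: a + t *: b) /\
                (exists2 t : R, 0 < t < 1 & z = (1 - t) *: c + t *: d).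
    move=> h1 h2 h3 h4.
    pose u := orient c d a - orient c d b.
    have u0 : 0 < u by rewrite /u addr_gt0.
    have uE : u = orient a b d - orient a b c by rewrite /u /orient; ring.
    pose t1 := orient c d a / u.
    pose t2 := - orient a b c / u.
    exists ((1 - t1) *: a + t1 *: b); split.
      exists t1 => //; rewrite divr_gt0 //= ltr_pdivrMr // mul1r /u; lra.
    exists t2; first by rewrite divr_gt0 //= ltr_pdivrMr // mul1r uE; lra.
    have u1 : u != 0 by rewrite gt_eqF.
    have i01 (i : 'I_2) : i = 0 \/ i = 1.
      by case: i => -[|[|m]] //= im; [left|right]; apply/val_inj.
    apply/rowP => i; rewrite !mxE /t1 /t2; move: u1; rewrite /u /orient.
    by case: (i01 i) => ->; move=> u1; field.
  case/orP: cr => /and3P[h1 h2 h3].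
    have [z [z1 z2]] : exists z, (exists2 t : R, 0 < t < 1 & z = (1 - t) *: x p + t *: x q) /\
                (exists2 t : R, 0 < t < 1 & z = (1 - t) *: x r + t *: x s).
      by apply: key; rewrite ?oppr_gt0; [apply: oneg|apply: opos|apply: opos2|apply: oneg]; apply/andP.
    by exists z.
  have [z [z1 z2]] : exists z, (exists2 t : R, 0 < t < 1 & z = (1 - t) *: x r + t *: x s) /\
                (exists2 t : R, 0 < t < 1 & z = (1 - t) *: x p + t *: x q).
    by apply: key; rewrite ?oppr_gt0; [apply: oneg|apply: opos|apply: opos2|apply: oneg]; apply/andP.
  by exists z.
case=> DE [z [[t /andP[t0 t1] zt] [u /andP[u0 u1] zu]]].
rewrite /= in zt zu.
have zpq : orient (x p) (x q) z = 0.
  by rewrite zt orient_lin orient_aab orient_abb !mulr0 addr0.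
have u1' : 0 < 1 - u by rewrite subr_gt0.
apply: contra_notT DE => ncr; apply/val_inj => /=.
have sgn (a : 'I_n.+3) : [/\ (p < a < q)%N -> orient (x p) (x q) (x a) < 0,
   (a < p)%N || (q < a)%N -> 0 < orient (x p) (x q) (x a) &
   (a == p) || (a == q) -> orient (x p) (x q) (x a) = 0].
  split.
  - by move=> h; apply: oneg.
  - by case/orP => h; [apply: opos2; rewrite h|apply: opos; rewrite pq].
  - by case/orP => /eqP ->; rewrite ?orient_aab ?orient_abb.
have [r1 r2 r3] := sgn r; have [s1 s2 s3] := sgn s.
move: zpq; rewrite zu orient_lin => zpq.
have side (v w : R) : (v < 0 /\ w <= 0) \/ (v <= 0 /\ w < 0) \/
    (0 < v /\ 0 <= w) \/ (0 <= v /\ 0 < w) -> (1 - u) * v + u * w <> 0.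
  have m1 a b : 0 < a -> b < 0 -> a * b < 0 :> R by move=> a0 b0; rewrite pmulr_rlt0.
  have m2 a b : 0 < a -> b <= 0 -> a * b <= 0 :> R by move=> a0 b0; rewrite pmulr_rle0.
  case=> [[]|[[]|[[]|[]]]] vs ws; apply/eqP.
  - by rewrite lt_eqF // ltr_nwDl ?m1 ?m2.
  - by rewrite lt_eqF // ltr_nwDr ?m1 ?m2.
  - by rewrite gt_eqF // ltr_pwDl ?mulr_gt0 // mulr_ge0 // ltW.
  - by rewrite gt_eqF // ltr_pwDr ?mulr_gt0 // mulr_ge0 // ltW.
have cls (a : 'I_n.+3) : [\/ (p < a < q)%N, (a < p)%N || (q < a)%N | (a == p) || (a == q)].
  have : (p < a < q)%N || ((a < p)%N || (q < a)%N) || ((a == p) || (a == q)).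
    by rewrite -!val_eqE /=; case: (ltngtP a p) => ?; case: (ltngtP a q) => ? //; lia.
  by case/orP => [/orP[]|] h; [constructor 1|constructor 2|constructor 3].
case: (cls r) => hr; [have or := r1 hr|have or := r2 hr|have or := r3 hr];
  (case: (cls s) => hs; [have os := s1 hs|have os := s2 hs|have os := s3 hs]).
- by case: (side _ _ _ zpq); left; rewrite or ltW.
- by case/negP: ncr; apply: crossn_inl.
- by case: (side _ _ _ zpq); left; rewrite or os.
- by case/negP: ncr; apply: crossn_inr.
- by case: (side _ _ _ zpq); do 2 right; left; rewrite or ltW.
- by case: (side _ _ _ zpq); do 2 right; left; rewrite or os.
- by case: (side _ _ _ zpq); right; left; rewrite or os.
- by case: (side _ _ _ zpq); do 3 right; rewrite or os.
- case/orP: hr rs => /eqP ->; case/orP: hs => /eqP -> //; rewrite ?ltnn //= => qp.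
  by move: (ltn_trans pq qp); rewrite ltnn.
Qed.

End Chords.

(** * Flips of triangulations *)

Section Flips.
Variable n : nat.
Implicit Types (D E G : polygon_diagonal n) (A T : {set polygon_diagonal n}).

Definition ncb A : bool :=
  [forall D in A, forall E in A, ~~ crossb D E].

Lemma ncbP A :
  reflect (forall D E, D \in A -> E \in A -> ~~ crossb D E) (ncb A).
Proof.
apply: (iffP forall_inP) => [h D E /h /forall_inP|h D DA]; first exact.
by apply/forall_inP => E; apply: h.
Qed.

Lemma ncbS A T : A \subset T -> ncb T -> ncb A.
Proof.
move=> /fintype.subsetP AT /ncbP h; apply/ncbP => D E DA EA.
by apply: h; apply: AT.
Qed.

Definition maxnc T : Prop :=
  ncb T /\ forall D, (forall E, E \in T -> ~~ crossb D E) -> D \in T.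

Lemma ncb_extend A : ncb A -> exists2 T : {set polygon_diagonal n}, A \subset T & maxnc T.
Proof.
move=> ncA; have [T /maxsetP[ncT maxT] AT] := maxset_exists ncA.
exists T => //; split=> // D DT.
rewrite -(maxT (D |: T)) ?setU11 //; last exact: finset.subsetUr.
apply/ncbP => E G; rewrite !inE => /orP[/eqP->|ET] /orP[/eqP->|GT].
- by rewrite crossbb.
- exact: DT.
- by rewrite crossbC; apply: DT.
- by move/ncbP: ncT; apply.
Qed.

Definition edge T (a b : nat) : Prop :=
  [/\ (a < b)%N, (b < n.+3)%N & diagn n a b ->
      exists2 D, D \in T & fst_end D = a /\ snd_end D = b].

Lemma edge_side T a b : (a < b < n.+3)%N -> ~~ diagn n a b -> edge T a b.
Proof. by case/andP=> ab bn h; split=> // /(negP h). Qed.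

Lemma edge_mem T D : D \in T -> edge T (fst_end D) (snd_end D).
Proof.
by move=> DT; have /and3P[] := diagnP D; split=> // [|_]; [exact: diag_lt|exists D].
Qed.

Lemma edge_max T a b : maxnc T -> (a < b < n.+3)%N ->
  (forall E, E \in T -> ~~ crossn a b (fst_end E) (snd_end E)) -> edge T a b.
Proof.
case=> _ maxT /andP[ab bn] h; split=> // /(@diagn_ex n) [D Da Db].
by exists D => //; apply: maxT => E ET; rewrite /crossb Da Db; apply: h.
Qed.

Lemma side_crossn a b E : (a < b < n.+3)%N -> ~~ diagn n a b ->
  ~~ crossn a b (fst_end E) (snd_end E).
Proof. by have /and3P[] := diagnP E; rewrite /diagn /crossn; lia. Qed.

Lemma edge_nc T a b E : ncb T -> edge T a b -> E \in T ->
  ~~ crossn a b (fst_end E) (snd_end E).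
Proof.
move=> /ncbP ncT [ab bn h] ET; have [/h[D DT [<- <-]]|dn] := boolP (diagn n a b).
  exact: ncT.
by apply: side_crossn dn; rewrite ab.
Qed.

Lemma triangle_above T a b : maxnc T -> edge T a b -> (a.+1 < b)%N ->
  exists2 r, (a < r < b)%N & edge T a r /\ edge T r b.
Proof.
move=> mT eab ab1; have [ncT _] := mT; have [ab bn _] := eab.
have P0 : exists r, `[< (a < r < b)%N /\ edge T a r >].
  exists a.+1; apply/asboolP; split; first by rewrite ltnSn.
  by apply: edge_side; rewrite /diagn; lia.
have Pb r : `[< (a < r < b)%N /\ edge T a r >] -> (r <= b)%N by move/asboolP; lia.
case: (ex_maxnP P0 Pb) => r /asboolP[arb ear] rmax.
exists r => //; split=> //; apply: edge_max => // [|E ET]; first by lia.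
have h1 := edge_nc ncT eab ET; have h2 := edge_nc ncT ear ET.
have h3 : fst_end E = a -> (snd_end E < b)%N -> (snd_end E <= r)%N.
  move=> Ea Eb; apply: rmax; apply/asboolP; have := edge_mem ET.
  by rewrite Ea => h; split=> //; case: h => ->.
by have := diag_lt E; move: h1 h2 h3; rewrite /crossn; lia.
Qed.

Definition chords_of (a b c d : nat) D E : Prop :=
  ((fst_end D = a /\ snd_end D = c) /\ (fst_end E = b /\ snd_end E = d)) \/
  ((fst_end D = b /\ snd_end D = d) /\ (fst_end E = a /\ snd_end E = c)).

Definition quad T (a b c d : nat) : Prop :=
  [/\ edge T a b, edge T b c, edge T c d & edge T a d].

Lemma quad_only a b c d D E G : (a < b < c)%N -> (c < d)%N -> chords_of a b c d D E ->
  ~~ crossn a b (fst_end G) (snd_end G) -> ~~ crossn b c (fst_end G) (snd_end G) ->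
  ~~ crossn c d (fst_end G) (snd_end G) -> ~~ crossn a d (fst_end G) (snd_end G) ->
  crossb D G -> G = E.
Proof.
move=> abc cd chDE h1 h2 h3 h4 cr; have := diag_lt G; move: h1 h2 h3 h4 cr.
case: chDE => -[[D1 D2] [E1 E2]]; rewrite /crossb /crossn D1 D2 => *;
  apply: diag_inj; rewrite ?E1 ?E2; lia.
Qed.

Lemma chordsC a b c d D E : chords_of a b c d D E -> chords_of a b c d E D.
Proof. by case=> -[h1 h2]; [right|left]. Qed.

Lemma chords_cross a b c d D E : (a < b < c)%N -> (c < d)%N ->
  chords_of a b c d D E -> crossb D E.
Proof.
by move=> abc cd; case=> -[[D1 D2] [E1 E2]]; rewrite /crossb /crossn D1 D2 E1 E2; lia.
Qed.

Lemma edge_setU1D T D E a b : edge T a b -> ~ (fst_end D = a /\ snd_end D = b) ->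
  edge (E |: T :\ D) a b.
Proof.
move=> [ab bn h] nD; split=> // /h[G GT [Ga Gb]]; exists G => //.
by rewrite !inE GT andbT; apply/orP; right; apply/eqP => GD; apply: nD; rewrite -GD.
Qed.

Lemma flip_maxnc T a b c d D E : maxnc T -> (a < b < c)%N -> (c < d)%N ->
  quad T a b c d -> chords_of a b c d D E -> D \in T ->
  [/\ maxnc (E |: T :\ D), quad (E |: T :\ D) a b c d, E \notin T &
      #|E |: T :\ D| = #|T|].
Proof.
move=> [ncT maxT] abc cd [e1 e2 e3 e4] chDE DT.
have /ncbP ncT' := ncT.
have DE := chords_cross abc cd chDE.
have ET : E \notin T by apply: contraTN DE => ET; apply: ncT'.
have ncE G : G \in T -> G != D -> ~~ crossb E G.
  move=> GT; apply: contra => EG; apply/eqP.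
  by apply: quad_only abc cd (chordsC chDE) _ _ _ _ EG; exact: edge_nc GT.
have qT : quad (E |: T :\ D) a b c d.
  by split; apply: edge_setU1D => //; case: chDE => -[[D1 D2] _]; lia.
have ncF : ncb (E |: T :\ D).
  apply/ncbP => G H; rewrite !inE => /orP[/eqP->|/andP[GD GT]] /orP[/eqP->|/andP[HD HT]].
  - by rewrite crossbb.
  - exact: ncE.
  - by rewrite crossbC; apply: ncE.
  - exact: ncT'.
split=> //; last first.
  by rewrite cardsU1 !inE (negPf ET) andbF /= add1n (cardsD1 D T) DT.
split=> // G hG; rewrite !inE.
have [//|GE] := eqVneq G E; rewrite orFb.
have [q1 q2 q3 q4] := qT.
have GD : G != D.
  apply/eqP => GD; move: (hG E); rewrite setU11 GD DE => /(_ isT); done.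
rewrite GD /=; apply: maxT => H HT; have [->|HD] := eqVneq H D; last first.
  by apply: hG; rewrite !inE HD HT orbT.
rewrite crossbC; apply: contraNN GE => DG; apply/eqP.
have gn u v : edge (E |: T :\ D) u v -> ~~ crossn u v (fst_end G) (snd_end G).
  case=> uv vn h; have [/h[H' H'T [<- <-]]|dn] := boolP (diagn n u v); last first.
    by apply: side_crossn dn; rewrite uv.
  by rewrite -/(crossb H' G) crossbC; apply: hG.
by apply: quad_only abc cd chDE _ _ _ _ DG; apply: gn.
Qed.

Section FlipInduction.
Variable Q : {set polygon_diagonal n} -> Prop.
Hypothesis Q_flip : forall T a b c d D E, maxnc T -> (a < b < c)%N -> (c < d)%N ->
  quad T a b c d -> chords_of a b c d D E -> D \in T -> Q T -> Q (E |: T :\ D).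

Definition star0 T : nat := #|[set D in T | fst_end D == 0%N]|.

Definition fan0 : {set polygon_diagonal n} := [set D | fst_end D == 0%N].

Lemma flip_to_fan0 T : maxnc T -> T != fan0 ->
  exists a b c d D E, [/\ (a < b < c)%N, (c < d)%N, quad T a b c d,
    chords_of a b c d D E & D \in T /\ (star0 T < star0 (E |: T :\ D))%N].
Proof.
move=> mT Tn; have [ncT maxT] := mT.
have [D0 [D00 D0T]] : exists D, fst_end D = 0%N /\ D \notin T.
  apply: contrapT => hD; case/eqP: Tn; apply/eqP; rewrite finset.eqEsubset.
  have fT : fan0 \subset T.
    apply/fintype.subsetP => D; rewrite inE => /eqP D0; apply: contrapT => /negP DT.
    by apply: hD; exists D.
  rewrite fT andbT; apply/fintype.subsetP => D DT; rewrite inE.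
  apply: contraT => D0; have /and3P[h1 h2 _] := diagnP D.
  have dk : diagn n 0 (fst_end D).+1 by rewrite /diagn; lia.
  have [E E0 E1] := diagn_ex dk.
  have ET : E \in T by apply: (fintype.subsetP fT); rewrite inE E0.
  by move/ncbP: ncT => /(_ _ _ DT ET); rewrite /crossb /crossn E0 E1; lia.
set k := snd_end D0; have kd := diagnP D0; rewrite D00 -/k in kd.
have P0 : exists j, `[< (0 < j < k)%N /\ edge T 0 j >].
  exists 1%N; apply/asboolP; split; first by move: kd; rewrite /diagn; lia.
  by apply: edge_side; rewrite /diagn; lia.
have Pk j : `[< (0 < j < k)%N /\ edge T 0 j >] -> (j <= k)%N by move/asboolP; lia.
case: (ex_maxnP P0 Pk) => a /asboolP[a0k e0a] amax {P0 Pk}.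
have P0 : exists j, `[< (k < j < n.+3)%N /\ edge T 0 j >].
  exists n.+2; apply/asboolP; split; first by move: kd; rewrite /diagn; lia.
  by apply: edge_side; rewrite /diagn; lia.
case: (ex_minnP P0) => b /asboolP[kb e0b] bmin {P0}.
have eab : edge T a b.
  apply: edge_max => // [|E ET]; first by lia.
  have h1 := edge_nc ncT e0a ET; have h2 := edge_nc ncT e0b ET.
  have Ek : fst_end E = 0%N -> snd_end E != k.
    move=> E0; apply: contraNN D0T => /eqP E1.
    by rewrite (_ : D0 = E) //; apply: diag_inj; rewrite ?E0.
  have h3 : fst_end E = 0%N -> (snd_end E < k)%N -> (snd_end E <= a)%N.
    move=> E0 E1; apply: amax; apply/asboolP; have := edge_mem ET.
    by rewrite E0 => h; split=> //; case: h => ->.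
  have h4 : fst_end E = 0%N -> (k < snd_end E)%N -> (b <= snd_end E)%N.
    move=> E0 E1; apply: bmin; apply/asboolP; have := edge_mem ET.
    by rewrite E0 => h; split=> //; case: h => _ ->; rewrite E1.
  by have := diag_lt E; move: h1 h2 h3 h4 Ek; rewrite /crossn; lia.
have [r arb [ear erb]] := triangle_above mT eab (ltac:(lia)).
have [_ _ /(_ (ltac:(rewrite /diagn; lia)))[D DT [Da Db]]] := eab.
have dr : diagn n 0 r by rewrite /diagn; lia.
have [E E0 Er] := diagn_ex dr.
exists 0%N, a, r, b, D, E; split=> //; first by lia.
- by lia.
- by right.
split=> //; apply: proper_card; apply/properP; split.
  apply/fintype.subsetP => G; rewrite !inE => /andP[GT /eqP G0]; rewrite G0 eqxx GT !andbT.
  by apply/orP; right; apply/eqP => GD; move: Da; rewrite -GD G0; lia.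
exists E; first by rewrite !inE E0 !eqxx.
rewrite inE E0 eqxx andbT; apply: contraT; rewrite negbK => ET.
by move/ncbP: ncT => /(_ _ _ DT ET); rewrite /crossb /crossn E0 Er Da Db; lia.
Qed.

Lemma flip_to_from_fan0 T : maxnc T -> (Q T <-> Q fan0) /\ #|T| = #|fan0|.
Proof.
have [m] := ubnP (#|{: polygon_diagonal n}| - star0 T)%N.
elim: m T => // m IH T hm mT; have [->|Tn] := eqVneq T fan0; first by split.
have [a [b [c [d [D [E [abc cd qT chDE [DT lt_star]]]]]]]] := flip_to_fan0 mT Tn.
have [mF qF ET cF] := flip_maxnc mT abc cd qT chDE DT.
have [|QF <-] := IH (E |: T :\ D) _ mF.
  have : (star0 (E |: T :\ D) <= #|{: polygon_diagonal n}|)%N by exact: max_card.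
  by move: hm; lia.
split=> //; rewrite -QF; split; first exact: Q_flip chDE DT.
have TE : T = D |: (E |: T :\ D) :\ E.
  apply/setP => G; rewrite !inE; have [->|GE] /= := eqVneq G E.
    rewrite (negPf ET) orbF; apply/esym/eqP => EqD; move: (chords_cross abc cd chDE).
    by rewrite EqD crossbb.
  by have [->|] := eqVneq G D.
move=> QF'; rewrite TE.
exact: (Q_flip mF abc cd qF (chordsC chDE) (setU11 _ _) QF').
Qed.

End FlipInduction.

Lemma card_fan0 : #|fan0| = n.
Proof.
pose f (i : 'I_n) := (i.+2)%N.
have dk (i : 'I_n) : diagn n 0 i.+2 by have := ltn_ord i; rewrite /diagn; lia.
pose g (i : 'I_n) := s2val (cid2 (diagn_ex (dk i))).
have g1 i : fst_end (g i) = 0%N by rewrite /g; case: cid2.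
have g2 i : snd_end (g i) = i.+2 by rewrite /g; case: cid2.
have g_inj : injective g by move=> i j /(congr1 (@snd_end n)); rewrite !g2 => -[/ord_inj].
rewrite -[RHS]card_ord -cardsT -(card_imset _ g_inj).
congr #|pred_of_set _|; apply/setP => D; rewrite inE; apply/eqP/imsetP => [D0|[i _ ->]] //.
have := diagnP D; rewrite D0 => dD.
have Dn : ((snd_end D).-2 < n)%N by move: dD; rewrite /diagn; lia.
exists (Ordinal Dn) => //; apply: diag_inj; rewrite ?g1 ?g2 //=.
by move: dD; rewrite /diagn; lia.
Qed.

Lemma maxnc_card T : maxnc T -> #|T| = n.
Proof.
by move=> mT; have [|_ ->] := @flip_to_from_fan0 (fun=> True) _ T mT; rewrite ?card_fan0.
Qed.

Lemma maxnc_ncb T : ncb T -> #|T| = n -> maxnc T.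
Proof.
move=> ncT cT; have [T' TT' mT'] := ncb_extend ncT.
suff -> : T = T' by [].
by apply/eqP; rewrite eqEcard TT' cT (maxnc_card mT') leqnn.
Qed.

Lemma flip_ind (Q : {set polygon_diagonal n} -> Prop) T0 :
  (forall T a b c d D E, maxnc T -> (a < b < c)%N -> (c < d)%N ->
    quad T a b c d -> chords_of a b c d D E -> D \in T -> Q T -> Q (E |: T :\ D)) ->
  maxnc T0 -> Q T0 -> forall T, maxnc T -> Q T.
Proof.
move=> Qf mT0 QT0 T mT; have [QT _] := flip_to_from_fan0 Qf mT.
by have [QF _] := flip_to_from_fan0 Qf mT0; apply/QT/QF.
Qed.

End Flips.

(** * Relations in a quadrilateral *)

Section QuadrilateralIdentities.
Local Open Scope nat_scope.

(* The coefficients (l, m, (k1, k2, k3, k4)) express l v_ac + m v_bd as the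
   combination k1 c_ab + k2 c_bc + k3 c_cd + k4 c_ad, here on the coordinate of the
   seed diagonal st. *)
Definition quad_identity (k : nat * nat * (nat * nat * nat * nat)) (a b c d s t : nat) : bool :=
  let: (l, m, (k1, k2, k3, k4)) := k in
  l * crossn a c s t + m * crossn b d s t ==
  ((s == a) && (t == c)) + ((s == b) && (t == d)) +
  (k1 * crossn a b s t + k2 * crossn b c s t + k3 * crossn c d s t + k4 * crossn a d s t).

(* The last four shapes occur when the seed has, from one of the vertices a, b, c, d,
   diagonals through both opposite sides of the quadrilateral. *)
Definition quad_identities : seq (nat * nat * (nat * nat * nat * nat)) :=
  [:: (1, 1, (1, 0, 1, 0)); (1, 1, (0, 1, 0, 1));
      (2, 1, (0, 1, 1, 0)); (1, 2, (0, 0, 1, 1));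
      (2, 1, (1, 0, 0, 1)); (1, 2, (1, 1, 0, 0))].

(* The position of x relative to a < b < c < d: these four are sent to 1, 3, 5, 7
   and the five gaps around them to 0, 2, 4, 6, 8. *)
Definition slot (a b c d x : nat) : nat :=
  (a <= x) + (a < x) + (b <= x) + (b < x) + (c <= x) + (c < x) + (d <= x) + (d < x).

Section Slot.
Variables a b c d : nat.
Hypotheses (abc : a < b < c) (cd : c < d).

Lemma slot_iota x : slot a b c d x \in iota 0 9.
Proof.
by rewrite mem_iota add0n ltnS -[8]/(1 + 1 + 1 + 1 + 1 + 1 + 1 + 1) !leq_add ?leq_b1.
Qed.

Lemma slot_mono x y : slot a b c d x < slot a b c d y -> x < y.
Proof. by rewrite /slot; lia. Qed.

Lemma slot_vertices x :
  [/\ ((a < x) = (1 < slot a b c d x)) * ((x < a) = (slot a b c d x < 1))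
        * ((x == a) = (slot a b c d x == 1)),
      ((b < x) = (3 < slot a b c d x)) * ((x < b) = (slot a b c d x < 3))
        * ((x == b) = (slot a b c d x == 3)),
      ((c < x) = (5 < slot a b c d x)) * ((x < c) = (slot a b c d x < 5))
        * ((x == c) = (slot a b c d x == 5)) &
      ((d < x) = (7 < slot a b c d x)) * ((x < d) = (slot a b c d x < 7))
        * ((x == d) = (slot a b c d x == 7))].
Proof. by rewrite /slot; move: abc cd => *; repeat split; lia. Qed.

Lemma slot_crossn s t u w :
  crossn (slot a b c d s) (slot a b c d t) (slot a b c d u) (slot a b c d w) ->
  crossn s t u w.
Proof.
by rewrite /crossn => /orP[] /and3P[/slot_mono-> /slot_mono-> /slot_mono->] //; rewrite orbT.
Qed.

Lemma slot_identity k s t :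
  quad_identity k a b c d s t = quad_identity k 1 3 5 7 (slot a b c d s) (slot a b c d t).
Proof.
case: k => [[l m] [[[k1 k2] k3] k4]]; rewrite /quad_identity /crossn.
have [sa sb sc sd] := slot_vertices s; have [ta tb tc td] := slot_vertices t.
by rewrite ?(sa, sb, sc, sd) ?(ta, tb, tc, td).
Qed.
End Slot.

Lemma quad_identities_slots :
  all (fun s => all (fun t => if s <= t then
    all (fun s' => all (fun t' => if s' <= t' then
      if crossn s t s' t' then true else
      if quad_identity (1, 1, (1, 0, 1, 0)) 1 3 5 7 s t then true else
      if quad_identity (1, 1, (0, 1, 0, 1)) 1 3 5 7 s' t' then true else
      has (fun k => all (fun u => all (fun w => if u <= w then
         if crossn s t u w then true else if crossn s' t' u w then true else
         quad_identity k 1 3 5 7 u w else true) (iota 0 9)) (iota 0 9)) quad_identities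
    else true) (iota 0 9)) (iota 0 9) else true) (iota 0 9)) (iota 0 9).
Proof. by vm_compute. Qed.

Lemma quad_identity_noncross (I : Type) (s t : I -> nat) a b c d :
  a < b < c -> c < d -> (forall i, s i < t i) ->
  (forall i j, ~~ crossn (s i) (t i) (s j) (t j)) ->
  exists2 k, k \in quad_identities & forall i, quad_identity k a b c d (s i) (t i).
Proof.
move=> abc cd st nc.
pose S x := slot a b c d x.
have S9 x : S x \in iota 0 9 by exact: slot_iota.
have Sst i : S (s i) <= S (t i).
  by rewrite leqNgt; apply: contraL (st i) => /(slot_mono abc cd) ts; rewrite -leqNgt ltnW.
have Snc i j : crossn (S (s i)) (S (t i)) (S (s j)) (S (t j)) = false.
  by apply/negbTE; apply: contra (nc i j); apply: (slot_crossn abc cd).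
have [h1|/existsNP[i /negP hi]] := pselect (forall i,
    quad_identity (1, 1, (1, 0, 1, 0)) a b c d (s i) (t i)).
  by exists (1, 1, (1, 0, 1, 0)).
have [h2|/existsNP[j /negP hj]] := pselect (forall i,
    quad_identity (1, 1, (0, 1, 0, 1)) a b c d (s i) (t i)).
  by exists (1, 1, (0, 1, 0, 1)).
move: hi hj; rewrite !(slot_identity abc cd) -!/(S _) => /negbTE hi /negbTE hj.
have /allP/(_ _ (S9 (s i)))/allP/(_ _ (S9 (t i))) := quad_identities_slots.
rewrite Sst => /allP/(_ _ (S9 (s j)))/allP/(_ _ (S9 (t j))).
rewrite Sst Snc hi hj => /hasP[k kq /allP hk]; exists k => // m.
have /allP/(_ _ (S9 (t m))) := hk _ (S9 (s m)).
by rewrite Sst !Snc (slot_identity abc cd).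
Qed.
End QuadrilateralIdentities.

Section Forms.
Variables (R : realType) (V : vectType R).
Implicit Types (f g : 'Hom(V, R^o)) (u w : V) (k : R).

Lemma form_add f u w : (f (u + w) : R) = (f u : R) + (f w : R).
Proof. by rewrite linearD. Qed.

Lemma form_scale f k u : (f (k *: u) : R) = k * (f u : R).
Proof. by rewrite linearZ. Qed.

Lemma form_sum f (I : Type) (r : seq I) (P : pred I) (F : I -> V) :
  (f (\sum_(i <- r | P i) F i) : R) = \sum_(i <- r | P i) (f (F i) : R).
Proof. by rewrite linear_sum. Qed.

Lemma addf_form f g u : ((f + g) u : R) = (f u : R) + (g u : R).
Proof. by rewrite add_lfunE. Qed.

Lemma scalef_form k f u : ((k *: f) u : R) = k * (f u : R).
Proof. by rewrite scale_lfunE. Qed.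

Lemma subf_form f g u : ((f - g) u : R) = (f u : R) - (g u : R).
Proof. by rewrite add_lfunE opp_lfunE. Qed.

Lemma sumf_form (I : Type) (r : seq I) (P : pred I) (F : I -> 'Hom(V, R^o)) u :
  ((\sum_(i <- r | P i) F i) u : R) = \sum_(i <- r | P i) (F i u : R).
Proof. by rewrite sum_lfunE. Qed.
End Forms.

Section Heights.
Variables (R : realType) (n : nat).

(* The number of pairs of sides of the polygon separated by the chord ab; these
   heights satisfy the triangle and the quadrangle inequalities strictly. *)
Definition chord_height (a b : nat) : R :=
  (b%:R - a%:R) * (n.+3%:R - (b%:R - a%:R)).

Lemma chord_height_gt0 a b : (a < b)%N -> (b < n.+3)%N -> 0 < chord_height a b.
Proof.
move=> ab bn; rewrite -(ltr_nat R) in ab; rewrite -(ltr_nat R) in bn.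
have a0 : 0 <= a%:R :> R by rewrite ler0n.
by rewrite mulr_gt0 ?subr_gt0 //; lra.
Qed.

Lemma chord_height_ineq a b c d l m k1 k2 k3 k4 :
  (a < b < c)%N -> (c < d)%N -> (d < n.+3)%N ->
  (l, m, (k1, k2, k3, k4)) \in quad_identities ->
  k1%:R * chord_height a b + k2%:R * chord_height b c + k3%:R * chord_height c d
    + k4%:R * chord_height a d
  < l%:R * chord_height a c + m%:R * chord_height b d.
Proof.
move=> /andP[]; rewrite -!(ltr_nat R) => ab bc cd dn.
have h0 : 0 < n.+3%:R - (d%:R - a%:R) :> R.
  by have := ler0n R a; lra.
rewrite -subr_gt0 in ab; rewrite -subr_gt0 in bc; rewrite -subr_gt0 in cd.
have := mulr_gt0 ab bc; have := mulr_gt0 ab cd; have := mulr_gt0 ab h0.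
have := mulr_gt0 bc cd; have := mulr_gt0 bc h0; have := mulr_gt0 cd h0.
rewrite /chord_height !inE => p1 p2 p3 p4 p5 p6.
by move=> /orP[|/orP[|/orP[|/orP[|/orP[]]]]] /eqP[-> -> -> -> -> ->]; lra.
Qed.
End Heights.

Section SeedVectors.
Variables (R : realType) (n : nat) (delta : 'I_n -> polygon_diagonal n).
Variables (V : vectType R) (alpha : n.-tuple V).
Hypothesis delta_inj : injective delta.
Hypothesis delta_nc : forall i j, ~~ crossb (delta i) (delta j).

Definition cross_vec (a b : nat) : V :=
  \sum_(i < n) (crossn a b (fst_end (delta i)) (snd_end (delta i)))%:R *: alpha`_i.

Definition seed_part (D : polygon_diagonal n) : V :=
  \sum_(i < n) (D == delta i)%:R *: alpha`_i.

Definition seed_vec (D : polygon_diagonal n) : V :=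
  cross_vec (fst_end D) (snd_end D) - seed_part D.

Definition in_seed (D : polygon_diagonal n) : bool := [exists i, D == delta i].

Lemma seed_part_delta i : seed_part (delta i) = alpha`_i.
Proof.
rewrite /seed_part (bigD1 i) //= eqxx scale1r big1 ?addr0 // => j ji.
by rewrite (inj_eq delta_inj) eq_sym (negPf ji) scale0r.
Qed.

Lemma seed_part_notin D : ~~ in_seed D -> seed_part D = 0.
Proof.
by move=> /existsPn h; rewrite /seed_part big1 // => i _; rewrite (negPf (h i)) scale0r.
Qed.

Lemma cross_vec_in D : in_seed D -> cross_vec (fst_end D) (snd_end D) = 0.
Proof.
case/existsP => i /eqP ->; rewrite /cross_vec big1 // => j _.
by move: (delta_nc i j); rewrite /crossb => /negPf ->; rewrite scale0r.
Qed.

Lemma seed_vec_delta i : seed_vec (delta i) = - alpha`_i.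
Proof.
rewrite /seed_vec cross_vec_in ?seed_part_delta ?sub0r //.
by apply/existsP; exists i.
Qed.

Lemma seed_vec_notin D : ~~ in_seed D -> seed_vec D = cross_vec (fst_end D) (snd_end D).
Proof. by move=> h; rewrite /seed_vec seed_part_notin ?subr0. Qed.

Lemma diag_vectorE (x : 'I_n.+3 -> 'rV[R]_2) : convex_polygon x ->
  diag_vector x delta alpha =1 seed_vec.
Proof.
move=> cx D; rewrite /diag_vector; case: pickP => [i /eqP <-|h].
  by rewrite seed_vec_delta.
rewrite seed_vec_notin; last by apply/existsPn => i; rewrite eq_sym h.
rewrite /cross_vec big_mkcond; apply: eq_bigr => i _.
rewrite (asbool_equiv_eq (crossesP cx _ _)) asboolb /crossb.
by case: crossn; rewrite ?scale1r ?scale0r.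
Qed.

(* Doubled on the seed: there a coefficient 2 of a relation drops to 1. *)
Definition seed_height (D : polygon_diagonal n) : R :=
  chord_height R n (fst_end D) (snd_end D) *+ (1 + in_seed D).

Lemma seed_vec_relation_sorted a b c d D E : (a < b < c)%N -> (c < d)%N -> (d < n.+3)%N ->
  fst_end D = a /\ snd_end D = c -> fst_end E = b /\ snd_end E = d ->
  exists l m k1 k2 k3 k4 : R,
  [/\ 0 < l /\ 0 < m, [/\ 0 <= k1, 0 <= k2, 0 <= k3 & 0 <= k4],
    l *: seed_vec D + m *: seed_vec E = k1 *: cross_vec a b + k2 *: cross_vec b c
      + k3 *: cross_vec c d + k4 *: cross_vec a d &
    k1 * chord_height R n a b + k2 * chord_height R n b c
      + k3 * chord_height R n c d + k4 * chord_height R n a d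
    < l * seed_height D + m * seed_height E].
Proof.
move=> abc cd dn [Da Dc] [Eb Ed].
have [[[l m] [[[k1 k2] k3] k4]] kq kid] :=
  quad_identity_noncross abc cd (fun i => diag_lt (delta i)) delta_nc.
have lin : l%:R *: cross_vec a c + m%:R *: cross_vec b d =
    seed_part D + seed_part E + (k1%:R *: cross_vec a b + k2%:R *: cross_vec b c
      + k3%:R *: cross_vec c d + k4%:R *: cross_vec a d).
  rewrite /cross_vec /seed_part !scaler_sumr -!big_split; apply: eq_bigr => i _.
  rewrite /= !scalerA -!scalerDl; congr (_ *: _).
  have isE (F : polygon_diagonal n) : (F == delta i)
      = (fst_end (delta i) == fst_end F) && (snd_end (delta i) == snd_end F).
    by apply/eqP/andP => [->|[/eqP h1 /eqP h2]] //; apply: diag_inj.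
  have := kid i; rewrite /quad_identity => /eqP/(congr1 (fun p : nat => p%:R : R)) /=.
  by rewrite !natrD !natrM !isE Da Dc Eb Ed.
have scaleE (p : nat) F : (if in_seed F then 1 else p%:R) *: seed_vec F =
    p%:R *: cross_vec (fst_end F) (snd_end F) - seed_part F.
  have [F0|F0] := boolP (in_seed F); last by rewrite seed_vec_notin ?seed_part_notin ?subr0.
  by rewrite /seed_vec cross_vec_in // scale1r scaler0.
have heightE (p : nat) F : (p <= 2)%N -> p%:R * chord_height R n (fst_end F) (snd_end F)
    <= (if in_seed F then 1 else p%:R) * seed_height F.
  move=> p2; rewrite /seed_height; case: (in_seed F); rewrite ?mulr1n // mul1r -[leRHS]mulr_natl.
  apply: ler_wpM2r; last by rewrite ler_nat.
  by rewrite ltW // chord_height_gt0 ?diag_lt //; case/and3P: (diagnP F).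
have [l0 m0] : (0 < l <= 2)%N /\ (0 < m <= 2)%N.
  have : all (fun k => [&& 0 < k.1.1 <= 2 & 0 < k.1.2 <= 2])%N quad_identities by [].
  by move/allP/(_ _ kq)/andP.
have ineq := chord_height_ineq R abc cd dn kq.
exists (if in_seed D then 1 else l%:R), (if in_seed E then 1 else m%:R).
exists k1%:R, k2%:R, k3%:R, k4%:R; split.
- by split; case: ifP => // _; rewrite ltr0n; lia.
- by rewrite !ler0n.
- by rewrite !scaleE Da Dc Eb Ed addrACA lin -opprD addrC addKr.
apply: lt_le_trans ineq _; apply: lerD.
  by have := heightE l D; rewrite Da Dc; apply; case/andP: l0.
by have := heightE m E; rewrite Eb Ed; apply; case/andP: m0.
Qed.

Lemma seed_vec_relation a b c d D E : (a < b < c)%N -> (c < d)%N -> (d < n.+3)%N ->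
  chords_of a b c d D E ->
  exists l m k1 k2 k3 k4 : R,
  [/\ 0 < l /\ 0 < m, [/\ 0 <= k1, 0 <= k2, 0 <= k3 & 0 <= k4],
    l *: seed_vec D + m *: seed_vec E = k1 *: cross_vec a b + k2 *: cross_vec b c
      + k3 *: cross_vec c d + k4 *: cross_vec a d &
    k1 * chord_height R n a b + k2 * chord_height R n b c
      + k3 * chord_height R n c d + k4 * chord_height R n a d
    < l * seed_height D + m * seed_height E].
Proof.
move=> abc cd dn [] [h1 h2]; first exact: seed_vec_relation_sorted.
have [l [m [k1 [k2 [k3 [k4 [[l0 m0] k0 e1 e2]]]]]]] :=
  seed_vec_relation_sorted abc cd dn h2 h1.
exists m, l, k1, k2, k3, k4; split=> //; first by rewrite addrC.
by rewrite [X in _ < X]addrC.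
Qed.

Lemma cross_vec_side a b : (a < b < n.+3)%N -> ~~ diagn n a b -> cross_vec a b = 0.
Proof.
move=> ab dn; rewrite /cross_vec big1 // => i _.
by rewrite (negPf (side_crossn (delta i) ab dn)) scale0r.
Qed.

Section Admissible.
Variable f : 'Hom(V, R^o).
Hypothesis f_le : forall D, (f (seed_vec D) : R) <= seed_height D.

Lemma cross_vec_le a b : (a < b < n.+3)%N -> (f (cross_vec a b) : R) <= chord_height R n a b.
Proof.
move=> ab; have h0 : 0 <= chord_height R n a b.
  by case/andP: ab => *; rewrite ltW ?chord_height_gt0.
have [/diagn_ex[D Da Db]|dn] := boolP (diagn n a b); last by rewrite cross_vec_side // linear0.
rewrite -Da -Db; have [D0|D0] := boolP (in_seed D).
  by rewrite cross_vec_in // linear0 Da Db.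
have := f_le D; rewrite seed_vec_notin // /seed_height (negPf D0) /=.
by rewrite addn0 mulr1n.
Qed.

Lemma admissible_active_ncb : ncb [set D | (f (seed_vec D) : R) == seed_height D].
Proof.
apply/ncbP => D E; rewrite !inE => /eqP fD /eqP fE; apply/negP => DE.
have [a [b [c [d [abc cd dn chDE]]]]] : exists a b c d,
    [/\ (a < b < c)%N, (c < d)%N, (d < n.+3)%N & chords_of a b c d D E].
  have /and3P[_ Dn _] := diagnP D; have /and3P[_ En _] := diagnP E.
  case/orP: DE => /and3P[h1 h2 h3].
    by exists (fst_end D), (fst_end E), (snd_end D), (snd_end E); split=> //; [rewrite h1|left].
  by exists (fst_end E), (fst_end D), (snd_end E), (snd_end D); split=> //; [rewrite h1|right].
have [abn bcn cdn adn] : [/\ (a < b < n.+3)%N, (b < c < n.+3)%N, (c < d < n.+3)%N &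
    (a < d < n.+3)%N] by move: abc cd dn; clear=> *; split; lia.
have [l [m [k1 [k2 [k3 [k4 [[l0 m0] [p1 p2 p3 p4] e1 e2]]]]]]] :=
  seed_vec_relation abc cd dn chDE.
have : (f (l *: seed_vec D + m *: seed_vec E) : R) = f (k1 *: cross_vec a b
    + k2 *: cross_vec b c + k3 *: cross_vec c d + k4 *: cross_vec a d) by rewrite e1.
 rewrite !form_add !form_scale fD fE => e3.
have hle k p q : 0 <= k -> (p < q < n.+3)%N ->
    k * (f (cross_vec p q) : R) <= k * chord_height R n p q.
  by move=> k0 pq; rewrite ler_wpM2l // cross_vec_le.
have q1 := hle _ a b p1 abn; have q2 := hle _ b c p2 bcn.
have q3 := hle _ c d p3 cdn; have q4 := hle _ a d p4 adn.
have := lerD (lerD (lerD q1 q2) q3) q4; rewrite leNgt => /negP; apply.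
by apply: lt_le_trans e2 _; rewrite -e3.
Qed.
End Admissible.

Lemma cross_vec_edge (T : {set polygon_diagonal n}) a b : edge T a b ->
  cross_vec a b = 0 \/ exists2 K, K \in T & fst_end K = a /\ snd_end K = b /\ cross_vec a b = seed_vec K.
Proof.
case=> ab bn h; have [/h[K KT [Ka Kb]]|dn] := boolP (diagn n a b); last first.
  by left; apply: cross_vec_side; rewrite ?ab.
have [K0|K0] := boolP (in_seed K); first by left; rewrite -Ka -Kb cross_vec_in.
by right; exists K => //; rewrite seed_vec_notin // Ka Kb.
Qed.

Lemma seed_height_gt0 D : 0 < seed_height D.
Proof.
rewrite /seed_height pmulrn_lgt0 // chord_height_gt0 ?diag_lt //.
by case/and3P: (diagnP D).
Qed.

Lemma exists_crossing D : exists E : polygon_diagonal n, crossb D E.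
Proof.
have /and3P[h1 h2 h3] := diagnP D.
have [ha|ha] := boolP (0 < fst_end D)%N.
  have [E E1 E2] : exists2 E : polygon_diagonal n, fst_end E = 0%N & snd_end E = (fst_end D).+1.
    by apply: diagn_ex; rewrite /diagn; lia.
  by exists E; rewrite /crossb /crossn E1 E2; lia.
have [E E1 E2] : exists2 E : polygon_diagonal n,
    fst_end E = (fst_end D).+1 & snd_end E = (snd_end D).+1.
  by apply: diagn_ex; rewrite /diagn; lia.
by exists E; rewrite /crossb /crossn E1 E2; lia.
Qed.

Hypothesis alpha_basis : basis_of fullv alpha.

Lemma seed_vec_positive (g : 'Hom(V, R^o)) : g != 0 -> exists D, 0 < (g (seed_vec D) : R).
Proof.
move=> g0.
have [i gi] : exists i : 'I_n, (g alpha`_i : R) != 0.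
  apply: contrapT => h; case/eqP: g0; apply/lfunP => u; rewrite zero_lfunE.
  rewrite (coord_basis alpha_basis (memvf u)) linear_sum big1 // => i _.
  rewrite linearZ /=; suff -> : g alpha`_i = 0 by rewrite scaler0.
  by apply/eqP; apply: contrapT => /negP ne; apply: h; exists i.
have [[j gj]|h] := pselect (exists j : 'I_n, (g alpha`_j : R) < 0).
  by exists (delta j); rewrite seed_vec_delta linearN /= oppr_gt0.
have g_ge0 (j : 'I_n) : 0 <= (g alpha`_j : R) by rewrite leNgt; apply/negP => gj; apply: h; exists j.
have [E iE] := exists_crossing (delta i).
exists E; rewrite seed_vec_notin; last first.
  by apply/existsPn => j; apply: contraTneq iE => ->; apply: delta_nc.
rewrite /cross_vec linear_sum /= (bigD1 i) //= -/(crossb E (delta i)) crossbC iE scale1r.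
rewrite ltr_pwDl ?lt_neqAle ?g_ge0 ?andbT 1?eq_sym //.
by apply: sumr_ge0 => j _; rewrite linearZ /= mulr_ge0 // ler0n.
Qed.

End SeedVectors.

(** * Polytopes of a family of cones *)

Section FiniteCombinations.
Variables (R : realType) (W : vectType R) (I : finType).
Implicit Types (F : I -> W) (A B : {set I}) (a : I -> R).

(* Defs.v indexes the coefficients of a combination by positions in a list;
   the next two lemmas move them to the indices of a duplicate-free family. *)
Lemma coeffs_of_positions F (s : seq I) (c : 'I_(size (map F s)) -> R) : uniq s ->
  exists a, [/\ forall x, x \in s -> exists i, a x = c i,
    forall i, exists2 x, x \in s & c i = a x,
    \sum_i c i *: (map F s)`_i = \sum_(x <- s) a x *: F x &
    \sum_i c i = \sum_(x <- s) a x].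
Proof.
elim: s c => [|y s IH] c /=.
  by exists (fun=> 0); split=> // [[]//||]; rewrite big_ord0 big_nil.
case/andP=> ys us; have [a [ac ca e1 e2]] := IH (fun i => c (lift ord0 i)) us.
exists (fun x => if x == y then c ord0 else a x); split.
- move=> x; rewrite inE; case: eqVneq => [_ _|_ /= /ac[i ->]]; first by exists ord0.
  by exists (lift ord0 i).
- move=> i; case: (unliftP ord0 i) => [j ->|->]; last first.
    by exists y; rewrite ?mem_head ?eqxx.
  have [x xs ->] := ca j; exists x; first by rewrite inE xs orbT.
  by rewrite ifN //; apply: contraNneq ys => <-.
- rewrite big_ord_recl big_cons eqxx /= e1; congr (_ + _).
  by apply: eq_big_seq => x xs; rewrite ifN //; apply: contraNneq ys => <-.
- rewrite big_ord_recl big_cons eqxx /= e2; congr (_ + _).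
  by apply: eq_big_seq => x xs; rewrite ifN //; apply: contraNneq ys => <-.
Qed.

Lemma positions_of_coeffs F (s : seq I) a :
  exists c : 'I_(size (map F s)) -> R,
   [/\ forall i, exists2 x, x \in s & c i = a x,
    \sum_i c i *: (map F s)`_i = \sum_(x <- s) a x *: F x &
    \sum_i c i = \sum_(x <- s) a x].
Proof.
elim: s => [|y s [c [ca e1 e2]]] /=.
  by exists (fun=> 0); split=> [[]//||]; rewrite big_ord0 big_nil.
exists (fun i => if unlift ord0 i is Some j then c j else a y); split.
- move=> i; case: unliftP => [j _|_]; last by exists y; rewrite ?mem_head.
  by have [x xs ->] := ca j; exists x; rewrite // inE xs orbT.
- rewrite big_ord_recl big_cons unlift_none /= -e1; congr (_ + _).
  by apply: eq_bigr => i _; rewrite liftK.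
- rewrite big_ord_recl big_cons unlift_none /= -e2; congr (_ + _).
  by apply: eq_bigr => i _; rewrite liftK.
Qed.

Lemma cone_familyP F A w : cone [seq F x | x <- enum A] w <->
  exists2 a, (forall x, x \in A -> 0 <= a x) & w = \sum_(x in A) a x *: F x.
Proof.
split=> [[c c0 ->]|[a a0 ->]].
  have [a [ac _ -> _]] := coeffs_of_positions c (enum_uniq A).
  by exists a; rewrite ?big_enum // => x; rewrite -mem_enum => /ac[i ->].
have [c [ca e _]] := positions_of_coeffs F (enum A) a.
exists c; last by rewrite e big_enum.
by move=> i; have [x + ->] := ca i; rewrite mem_enum; apply: a0.
Qed.

Lemma convex_hull_familyP F A w : convex_hull [seq F x | x <- enum A] w <->
  exists a, [/\ forall x, x \in A -> 0 <= a x, \sum_(x in A) a x = 1 &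
    w = \sum_(x in A) a x *: F x].
Proof.
split=> [[c [c0 c1 ->]]|[a [a0 a1 ->]]].
  have [a [ac _ -> e]] := coeffs_of_positions c (enum_uniq A).
  exists a; rewrite big_enum in e; split; rewrite ?big_enum -?e //.
  by move=> x; rewrite -mem_enum => /ac[i ->].
have [c [ca e1 e2]] := positions_of_coeffs F (enum A) a.
exists c; split; rewrite ?e1 ?e2 ?big_enum //.
by move=> i; have [x + ->] := ca i; rewrite mem_enum; apply: a0.
Qed.

Lemma span_familyP F A w : w \in <<[seq F x | x <- enum A]>>%VS ->
  exists a, w = \sum_(x in A) a x *: F x.
Proof.
move=> /(@coord_span _ _ _ (in_tuple _)) ->.
have [a [_ _ e _]] := coeffs_of_positions
  (fun i => coord (in_tuple [seq F x | x <- enum A]) i w) (enum_uniq A).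
by exists a; rewrite big_enum in e.
Qed.

Lemma free_family F A :
  (forall a, \sum_(x in A) a x *: F x = 0 -> forall x, x \in A -> a x = 0) ->
  free [seq F x | x <- enum A].
Proof.
move=> h; apply/(@freeP _ _ _ (in_tuple _)) => c c0 i.
have [a [_ ca e _]] := coeffs_of_positions c (enum_uniq A).
have [x xA ->] := ca i; apply: h; last by rewrite -mem_enum.
by rewrite -[RHS]c0 /= e big_enum.
Qed.

Lemma free_form F A (c : I -> R) : free [seq F x | x <- enum A] ->
  exists f : 'Hom(W, R^o), forall x, x \in A -> (f (F x) : R) = c x.
Proof.
move=> fA; have [f fE] := linear_of_free [seq F x | x <- enum A]
  ([seq c x | x <- enum A] : seq R^o).
exists (linfun f) => x xA; rewrite lfunE.
have : map f [seq F x | x <- enum A] = [seq c x | x <- enum A] :> seq R^o.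
  by apply: fE; rewrite ?size_map.
by rewrite -map_comp => /eq_in_map/(_ x); apply; rewrite mem_enum.
Qed.

Lemma free_familyS F A B : A \subset B -> free [seq F x | x <- enum B] ->
  free [seq F x | x <- enum A].
Proof.
move=> AB; rewrite (@perm_free _ _ _ (map F (enum A ++ enum (B :\: A)))).
  by rewrite map_cat => /catl_free.
apply/perm_map/uniq_perm; rewrite ?enum_uniq // ?cat_uniq ?enum_uniq ?andbT /=.
  by apply/hasPn => x; rewrite !mem_enum inE => /andP[].
move=> x; rewrite mem_cat !mem_enum inE; have [/(fintype.subsetP AB)->|] //= := boolP (x \in A).
Qed.
End FiniteCombinations.

Lemma has_dim_uniq (R : realType) (W : vectType R) (P : set W) k l :
  has_dim P k -> has_dim P l -> k = l.
Proof.
case=> U [<- PU minU] [U' [<- PU' minU']]; congr (\dim _); apply/eqP.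
by rewrite eqEsubv minU // minU'.
Qed.

Lemma form_eval (R : realType) (V : vectType R)
    (F : 'Hom('Hom(V, R^o), R^o)) :
  exists u, forall f, F f = f u.
Proof.
pose X := vbasis {:V}; have bX : basis_of {:V} X := vbasisP _.
pose e i : 'Hom(V, R^o) := linfun (coord X i : V -> R^o).
exists (\sum_(i < \dim {:V}) (F (e i) : R) *: X`_i) => f.
have fE : f = \sum_(i < \dim {:V}) (f X`_i : R) *: e i.
  apply/lfunP => u; rewrite sum_lfunE {1}(coord_basis bX (memvf u)) linear_sum.
  by apply: eq_bigr => i _; rewrite linearZ scale_lfunE lfunE; exact: mulrC.
rewrite {1}fE !linear_sum; apply: eq_bigr => i _.
by rewrite !linearZ; exact: mulrC.
Qed.

Section PolytopalFan.
Variables (R : realType) (V : vectType R) (I : finType).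
Variables (v : I -> V) (h : I -> R).
Local Notation form := 'Hom(V, R^o).
Implicit Types (f g p : form) (A B T : {set I}) (u : V).

Definition admissible f : Prop := forall D, (f (v D) : R) <= h D.

Definition active f : {set I} := [set D | (f (v D) : R) == h D].

Hypothesis v_positive : forall g, g != 0 -> exists D, 0 < (g (v D) : R).

Lemma walk f g : admissible f -> g != 0 ->
  exists t D, [/\ 0 <= t, 0 < (g (v D) : R), admissible (f + t *: g) &
    D \in active (f + t *: g)].
Proof.
move=> admf /v_positive[D0 gD0].
pose M D := (h D - f (v D)) / g (v D).
have [D gD Dmin] := @arg_minP _ _ _ D0 (fun D => 0 < (g (v D) : R)) M gD0.
exists (M D), D; split=> //.
- by rewrite divr_ge0 ?subr_ge0 // ltW.
- move=> E; rewrite addf_form scalef_form; have [gE|gE] := ltP 0 (g (v E) : R).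
    by have := Dmin E gE; rewrite {2}/M ler_pdivlMr // lerBrDl.
  apply: le_trans (admf E); rewrite gerDl mulr_ge0_le0 //.
  by rewrite divr_ge0 ?subr_ge0 // ltW.
- rewrite inE addf_form scalef_form /M mulfVK ?lt0r_neq0 //.
  by rewrite addrC subrK.
Qed.

Variable nc : pred {set I}.

Definition tri T : bool := nc T && (#|T| == \dim {:V}).

Hypothesis nc0 : nc finset.set0.
Hypothesis ncS : forall A B, A \subset B -> nc B -> nc A.
Hypothesis nc_active : forall f, admissible f -> nc (active f).
Hypothesis nc_extend : forall A, nc A -> exists2 T : {set I}, A \subset T & tri T.
Hypothesis tri_span : forall T, tri T -> <<[seq v D | D <- enum T]>>%VS = fullv.
Hypothesis tri_admissible : forall T, tri T ->
  exists2 f, admissible f & T \subset active f.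

Lemma tri_nc T : tri T -> nc T. Proof. by case/andP. Qed.

Lemma tri_card T : tri T -> #|T| = \dim {:V}. Proof. by case/andP=> _ /eqP. Qed.

Lemma tri_free T : tri T -> free [seq v D | D <- enum T].
Proof.
by move=> tT; rewrite /free tri_span // size_map -cardE tri_card.
Qed.

Lemma nc_free A : nc A -> free [seq v D | D <- enum A].
Proof. by case/nc_extend => T AT /tri_free; apply: free_familyS. Qed.

Lemma nc_card A : nc A -> (#|A| <= \dim {:V})%N.
Proof. by case/nc_extend => T AT /tri_card <-; apply: subset_leq_card. Qed.

Lemma tri_max T A : tri T -> nc A -> T \subset A -> A = T.
Proof.
move=> tT ncA TA; apply/esym/eqP.
by rewrite eqEcard TA (tri_card tT) nc_card.
Qed.

Lemma nc_form A (c : I -> R) : nc A ->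
  exists f, forall D, D \in A -> (f (v D) : R) = c D.
Proof. by move/nc_free/free_form => /(_ c). Qed.

Lemma tri_decomp T u : tri T -> exists a : I -> R, u = \sum_(D in T) a D *: v D.
Proof. by move=> tT; apply: span_familyP; rewrite tri_span ?memvf. Qed.

Lemma tri_form_eq T f g : tri T -> (forall D, D \in T -> f (v D) = g (v D)) -> f = g.
Proof.
move=> tT fg; apply/lfunP => u; have [a ->] := tri_decomp u tT.
rewrite !linear_sum; apply: eq_bigr => D DT.
by rewrite !linearZ /= fg.
Qed.

Definition tri_vertex T : form :=
  if pselect (exists2 f, admissible f & active f = T) is left e then s2val (cid2 e) else 0.

Lemma tri_vertexP T : tri T -> admissible (tri_vertex T) /\ active (tri_vertex T) = T.
Proof.
move=> tT; rewrite /tri_vertex; case: pselect => [e|[]]; first by case: cid2.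
have [f admf Tf] := tri_admissible tT; exists f => //.
by apply: tri_max => //; apply: nc_active.
Qed.

Lemma tri_vertex_eq T D : tri T -> ((tri_vertex T (v D) : R) == h D) = (D \in T).
Proof. by move=> tT; have [_ {2}<-] := tri_vertexP tT; rewrite inE. Qed.

Lemma tri_vertex_uniq T f : tri T -> T \subset active f -> tri_vertex T = f.
Proof.
move=> tT /fintype.subsetP Tf; apply: (tri_form_eq tT) => D DT.
have := Tf D DT; rewrite inE => /eqP ->; apply/eqP.
by rewrite tri_vertex_eq.
Qed.

Lemma tri_flip T D : tri T -> D \in T ->
  exists T' t g, [/\ tri T' /\ T :\ D \subset T', D \notin T', 0 < t,
    tri_vertex T' = tri_vertex T + t *: g &
    forall E, E \in T -> (g (v E) : R) = - (E == D)%:R].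
Proof.
move=> tT DT; have [g gE] := nc_form (fun E => - (E == D)%:R) (tri_nc tT).
have gD : (g (v D) : R) = -1 by rewrite gE // eqxx.
have g0 : g != 0.
  apply/eqP => g0; move: gD; rewrite g0 zero_lfunE => /esym/eqP.
  by rewrite oppr_eq0 oner_eq0.
have [admT actT] := tri_vertexP tT.
have [t [F [t0 gF admf actF]]] := walk admT g0.
set f := tri_vertex T + t *: g in admf actF.
have FT : F \notin T.
  by apply: contraTN gF => FT; rewrite gE // -leNgt oppr_le0 ler0n.
have {}t0 : 0 < t.
  rewrite lt_neqAle t0 andbT; apply: contraNneq FT => t0'.
  by move: actF; rewrite inE /f -t0' scale0r addr0 tri_vertex_eq.
have Df : D \notin active f.
  have fD : (tri_vertex T (v D) : R) = h D by apply/eqP; rewrite tri_vertex_eq.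
  rewrite inE addf_form scalef_form gD mulrN1 fD.
  by rewrite lt_eqF // ltrBlDr ltrDl.
have Tf : F |: T :\ D \subset active f.
  apply/fintype.subsetP => E; rewrite !inE => /orP[/eqP->|/andP[ED ET]].
    by move: actF; rewrite inE.
  by rewrite addf_form scalef_form gE // (negPf ED) oppr0 mulr0 addr0 tri_vertex_eq.
have ncf := nc_active admf.
have cf : #|F |: T :\ D| = #|T|.
  by rewrite cardsU1 !inE (negPf FT) andbF /= add1n (cardsD1 D T) DT.
have tf : tri (active f).
  rewrite /tri ncf eqn_leq nc_card //= -(tri_card tT) -cf.
  exact: subset_leq_card.
exists (active f), t, g; split=> //.
  by split=> //; apply: fintype.subset_trans Tf; apply: finset.subsetUr.
exact: tri_vertex_uniq.
Qed.

(* Take the vertex f_T maximising f_T u.  A negative coordinate of u in the basis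
   attached to T would make the value at u grow along the corresponding edge. *)
Lemma nc_complete u : exists2 A, nc A &
  exists2 a : I -> R, (forall D, D \in A -> 0 < a D) & u = \sum_(D in A) a D *: v D.
Proof.
have [T0 _ tT0] := nc_extend nc0.
have [T tT maxT] := @arg_maxP _ _ _ T0 tri (fun T => tri_vertex T u : R) tT0.
have [a uE] := tri_decomp u tT.
have a0 D : D \in T -> 0 <= a D.
  move=> DT; rewrite leNgt; apply/negP => aD.
  have [T' [t [g [[tT' _] _ t0 T'E gE]]]] := tri_flip tT DT.
  have : (tri_vertex T' u : R) <= tri_vertex T u by exact: maxT.
  rewrite T'E addf_form scalef_form gerDl leNgt => /negP; apply.
  rewrite mulr_gt0 // uE form_sum (bigD1 D) //= big1 => [|E /andP[ET ED]].
    by rewrite addr0 form_scale gE // eqxx mulrN1 oppr_gt0.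
  by rewrite form_scale gE // (negPf ED) oppr0 mulr0.
exists [set D in T | a D != 0].
  by apply: ncS (tri_nc tT); apply/fintype.subsetP => D; rewrite inE => /andP[].
exists a => [D|]; first by rewrite inE lt_neqAle eq_sym => /andP[DT ->]; apply: a0.
rewrite {1}uE (big_setID [set D | a D != 0]) /= [X in _ + X]big1 ?addr0 => [|D].
  by apply: eq_bigl => D; rewrite !inE.
by rewrite !inE negbK => /andP[/eqP-> _]; rewrite scale0r.
Qed.

Definition fan_polytope : set form :=
  convex_hull [seq tri_vertex T | T <- enum (finset tri)].

Definition fan_face A : set form :=
  [set p | fan_polytope p /\ forall D, D \in A -> (p (v D) : R) = h D].

Lemma fan_polytope_vertex T : tri T -> fan_polytope (tri_vertex T).
Proof.
move=> tT; apply/convex_hull_familyP; exists (fun T' => (T' == T)%:R); split.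
- by move=> T' _; rewrite ler0n.
- rewrite (bigD1 T) ?inE //= eqxx big1 ?addr0 // => T' /andP[_ /negPf->] //.
- rewrite (bigD1 T) ?inE //= eqxx scale1r big1 ?addr0 // => T' /andP[_ /negPf->].
  by rewrite scale0r.
Qed.

Lemma fan_polytope_admissible p : fan_polytope p -> admissible p.
Proof.
move=> /convex_hull_familyP[a [a0 a1 ->]] D.
rewrite sumf_form -[h D]mul1r -a1 mulr_suml; apply: ler_sum => T TT.
rewrite scalef_form ler_wpM2l ?a0 //; move: TT; rewrite inE => tT.
by have [/(_ D)] := tri_vertexP tT.
Qed.

Lemma fan_face_vertex A T : A \subset T -> tri T -> fan_face A (tri_vertex T).
Proof.
move=> AT tT; split; first exact: fan_polytope_vertex.
by move=> D /(fintype.subsetP AT) DT; apply/eqP; rewrite tri_vertex_eq.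
Qed.

Lemma fan_face_neq0 A : nc A -> fan_face A !=set0.
Proof. by case/nc_extend => T AT tT; exists (tri_vertex T); apply: fan_face_vertex. Qed.

Lemma tri_avoid A D : nc A -> D \notin A -> exists2 T, tri T & (A \subset T) && (D \notin T).
Proof.
move=> ncA DA; have [T AT tT] := nc_extend ncA; have [DT|DT] := boolP (D \in T); last first.
  by exists T; rewrite ?AT.
have [T' [_ [_ [[tT' TT'] DT' _ _ _]]]] := tri_flip tT DT.
exists T'; rewrite // DT' andbT; apply: fintype.subset_trans TT'; rewrite subsetD1 AT /=.
exact: DA.
Qed.

Lemma fan_face_sub A B : nc A -> fan_face A `<=` fan_face B <-> B \subset A.
Proof.
move=> ncA; split=> [AB|BA]; last first.
  by move=> p [Pp pA]; split=> // D /(fintype.subsetP BA); apply: pA.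
apply/fintype.subsetP => D DB; apply: contraT => /(tri_avoid ncA)[T tT /andP[AT DT]].
have [_ /(_ D DB)/eqP] := AB _ (fan_face_vertex AT tT).
by rewrite tri_vertex_eq // (negPf DT).
Qed.

Lemma fan_face_inj A B : nc A -> nc B -> fan_face A = fan_face B -> A = B.
Proof.
move=> ncA ncB AB; apply/eqP; rewrite finset.eqEsubset.
by apply/andP; split; [apply/(fan_face_sub A ncB)|apply/(fan_face_sub B ncA)]; rewrite AB.
Qed.

Section Positive.
Variables (A : {set I}) (a : I -> R).
Hypotheses (ncA : nc A) (a_gt0 : forall D, D \in A -> 0 < a D).

Lemma form_comb_le p : fan_polytope p ->
  (p (\sum_(D in A) a D *: v D) : R) <= \sum_(D in A) a D * h D.
Proof.
move=> Pp; rewrite form_sum; apply: ler_sum => D DA; rewrite form_scale.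
by rewrite ler_wpM2l ?fan_polytope_admissible // ltW ?a_gt0.
Qed.

Lemma form_comb_eq p : fan_polytope p ->
  (p (\sum_(D in A) a D *: v D) : R) = \sum_(D in A) a D * h D <-> fan_face A p.
Proof.
move=> Pp; split=> [pE|[_ pA]]; last first.
  by rewrite form_sum; apply: eq_bigr => D DA; rewrite form_scale pA.
split=> // D DA; apply/eqP; rewrite eq_le fan_polytope_admissible // leNgt.
apply/negP => lt; move/eqP: pE; rewrite lt_eqF // form_sum (bigD1 D) //=.
rewrite [ltRHS](bigD1 D) //= ltr_leD //; first by rewrite form_scale ltr_pM2l ?a_gt0.
apply: ler_sum => E /andP[EA _]; rewrite form_scale.
by rewrite ler_wpM2l ?fan_polytope_admissible // ltW ?a_gt0.
Qed.

Lemma face_of_comb b : (forall p, fan_polytope p -> (p (\sum_(D in A) a D *: v D) : R) <= b) ->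
  [set p | fan_polytope p /\ (p (\sum_(D in A) a D *: v D) : R) = b] !=set0 ->
  [set p | fan_polytope p /\ (p (\sum_(D in A) a D *: v D) : R) = b] = fan_face A.
Proof.
move=> le_b [q [Pq qb]]; have [q' q'A] := fan_face_neq0 ncA.
have bE : b = \sum_(D in A) a D * h D.
  apply/le_anti; rewrite -{1}qb form_comb_le //=.
  by have := le_b _ q'A.1; rewrite (form_comb_eq q'A.1).2.
rewrite predeqE => p; split=> [[Pp]|pA]; first by rewrite bE => /form_comb_eq; apply.
by split; [case: pA|rewrite bE; apply/form_comb_eq => //; case: pA].
Qed.
End Positive.

Lemma fan_polytope_faceP F : face fan_polytope F <-> exists2 A, nc A & F = fan_face A.
Proof.
split=> [[F0 [f [b [f_le FE]]]]|[A ncA ->]].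
  have [u fu] := form_eval f; have [A ncA [a a0 uE]] := nc_complete u.
  exists A => //; rewrite {}FE in F0 *.
  have sE : [set p | fan_polytope p /\ f p = b] =
      [set p | fan_polytope p /\ (p (\sum_(D in A) a D *: v D) : R) = b].
    by rewrite predeqE => p /=; rewrite fu uE.
  rewrite sE in F0 *; apply: face_of_comb => // p /f_le.
  by rewrite fu uE.
split; first exact: fan_face_neq0.
pose ev (f : form) : R^o := f (\sum_(D in A) 1 *: v D).
have ev_lin : linear ev by move=> k f g; rewrite /ev addf_form scalef_form.
pose evM := GRing.isLinear.Build _ _ _ _ ev ev_lin.
pose evL : {linear _ -> _} := HB.pack ev evM.
have evE p : (linfun evL p : R) = p (\sum_(D in A) 1 *: v D) by rewrite lfunE.
exists (linfun evL), (\sum_(D in A) 1 * h D); split=> [p Pp|].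
  by rewrite evE; apply: form_comb_le.
rewrite predeqE => p; split=> [pA|[Pp pE]].
  split; first by case: pA.
  by rewrite evE; apply/form_comb_eq => //; case: pA.
by move: pE; rewrite evE => /form_comb_eq; apply=> //.
Qed.

Lemma nc_conep A u : cone [seq v D | D <- enum A] u -> nc A ->
  exists B, [/\ B \subset A, nc B & exists2 a : I -> R,
     (forall D, D \in B -> 0 < a D) & u = \sum_(D in B) a D *: v D].
Proof.
move=> /cone_familyP[a a0 uE] ncA; exists [set D in A | a D != 0].
have sub : [set D in A | a D != 0] \subset A.
  by apply/fintype.subsetP => D; rewrite inE => /andP[].
split=> //; first exact: ncS ncA.
exists a => [D|]; first by rewrite inE lt_neqAle eq_sym => /andP[DT ->]; apply: a0.
rewrite uE (big_setID [set D | a D != 0]) /= [X in _ + X]big1 ?addr0 => [|D].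
  by apply: eq_bigl => D; rewrite !inE.
by rewrite !inE negbK => /andP[/eqP-> _]; rewrite scale0r.
Qed.

Lemma fan_normal_cone A : nc A ->
  normal_cone fan_polytope (fan_face A) = cone [seq v D | D <- enum A].
Proof.
move=> ncA; rewrite predeqE => u; split=> [nu|].
  have [B ncB [b b0 uE]] := nc_complete u.
  have [q qB] := fan_face_neq0 ncB.
  have AB : fan_face A `<=` fan_face B.
    move=> p pA; apply/(form_comb_eq b0 pA.1); apply/le_anti.
    rewrite form_comb_le //=; last by case: pA.
    by rewrite -(form_comb_eq b0 qB.1).2 // -uE; apply: nu => //; case: qB.
  move/(fan_face_sub B ncA)/fintype.subsetP: AB => BA.
  apply/cone_familyP; exists (fun D => if D \in B then b D else 0).
    by move=> D _; case: ifP => // /b0/ltW.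
  rewrite uE [RHS](big_setID B) /= [X in _ = _ + X]big1 ?addr0 => [|D].
    rewrite (_ : A :&: B = B); first by apply: eq_bigr => D ->.
    by apply/finset.setIidPr/fintype.subsetP.
  by rewrite inE => /andP[/negPf-> _]; rewrite scale0r.
move=> /nc_conep /(_ ncA)[B [BA ncB [b b0 ->]]] f g fA Pg.
apply: le_trans (form_comb_le b0 Pg) _.
by rewrite (form_comb_eq b0 fA.1).2 //; apply: ((fan_face_sub B ncA).2 BA f fA).
Qed.

Lemma fan_normal_fan : normal_fan fan_polytope =
  [set C | exists2 A, nc A & C = cone [seq v D | D <- enum A]].
Proof.
rewrite predeqE => C; split=> [[F /fan_polytope_faceP[A ncA ->] <-]|[A ncA ->]].
  by exists A => //; apply: fan_normal_cone.
exists (fan_face A); last exact: fan_normal_cone.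
by apply/fan_polytope_faceP; exists A.
Qed.

Lemma fan_face_dim A : nc A -> has_dim (fan_face A) (\dim {:V} - #|A|).
Proof.
move=> ncA; have [T AT tT] := nc_extend ncA.
pose g D : form := sval (cid (nc_form (fun E => - (E == D)%:R) (tri_nc tT))).
have gE D E : E \in T -> (g D (v E) : R) = - (E == D)%:R by rewrite /g; case: cid => f fE; apply: fE.
have gsum (B : {set I}) (c : I -> R) E : B \subset T -> E \in B ->
    ((\sum_(D in B) c D *: g D) (v E) : R) = - c E.
  move=> /fintype.subsetP BT EB; rewrite sumf_form (bigD1 E) //= scalef_form gE ?BT //.
  rewrite eqxx mulrN1 big1 ?addr0 // => D /andP[_ DE].
  by rewrite scalef_form gE ?BT // eq_sym (negPf DE) oppr0 mulr0.
have BT : T :\: A \subset T by exact: subsetDl.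
pose X := [seq g D | D <- enum (T :\: A)]; exists <<X>>%VS; split.
- have /eqnP -> : free X.
    apply: free_family => c c0 D DB; apply: oppr_inj.
    by rewrite -(gsum _ c D BT DB) c0 zero_lfunE oppr0.
  by rewrite size_map -cardE cardsDS // (tri_card tT).
- move=> p q [_ pA] [_ qA].
  have -> : p - q = \sum_(D in T :\: A) (- ((p - q) (v D) : R)) *: g D.
    apply: (tri_form_eq tT) => E ET; have [EA|EA] := boolP (E \in A).
      rewrite subf_form pA // qA // subrr sumf_form big1 // => D.
      rewrite inE => /andP[DA DT]; rewrite scalef_form gE // (_ : E == D = false) ?oppr0 ?mulr0 //.
      by apply: contraNF DA => /eqP <-.
    by rewrite gsum ?opprK // inE EA.
  apply: memv_suml => D DB; apply: memvZ; apply: memv_span.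
  by apply: map_f; rewrite mem_enum.
- move=> U' hU'; apply/span_subvP => w /mapP[D]; rewrite mem_enum inE => /andP[DA DT] ->.
  have [T' [t [g' [[tT' TT'] _ t0 T'E g'E]]]] := tri_flip tT DT.
  have -> : g D = t^-1 *: (tri_vertex T' - tri_vertex T).
    rewrite T'E addrC addKr scalerA mulVf ?lt0r_neq0 // scale1r.
    by apply: (tri_form_eq tT) => E ET; rewrite g'E // gE.
  apply/memvZ/hU'; last exact: fan_face_vertex.
  by apply: fan_face_vertex => //; apply: fintype.subset_trans TT'; rewrite subsetD1 AT.
Qed.

Lemma fan_face0 : fan_face finset.set0 = fan_polytope.
Proof. by rewrite predeqE => p; split=> [[]|Pp] //; split=> // D; rewrite inE. Qed.

Lemma fan_polytope_dim : has_dim fan_polytope (\dim {:V}).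
Proof. by have := fan_face_dim nc0; rewrite fan_face0 cards0 subn0. Qed.

Lemma fan_polytope_vertexP w : vertex fan_polytope w ->
  exists2 T, tri T & w = tri_vertex T.
Proof.
move=> /fan_polytope_faceP[A ncA wA]; have [T AT tT] := nc_extend ncA.
exists T => //; have := fan_face_vertex AT tT; rewrite -wA; exact: esym.
Qed.

Lemma fan_polytope_facetP F : facet fan_polytope F <->
  exists2 D, nc (finset.set1 D) & F = fan_face (finset.set1 D).
Proof.
split=> [[/fan_polytope_faceP[A ncA ->] [k [hP hF]]]|[D ncD ->]].
  have kd := has_dim_uniq hP fan_polytope_dim; have kA := has_dim_uniq hF (fan_face_dim ncA).
  have /eqP/cards1P[D AD] : #|A| = 1%N by have := nc_card ncA; lia.
  by exists D; rewrite -AD.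
split; first by apply/fan_polytope_faceP; exists (finset.set1 D).
have := nc_card ncD; rewrite cards1 => d0; exists (\dim {:V}).-1; split.
  by rewrite prednK //; apply: fan_polytope_dim.
by have := fan_face_dim ncD; rewrite cards1 subn1.
Qed.

Lemma fan_polytope_simple : simple_polytope fan_polytope.
Proof.
split.
  split; last by exists [seq tri_vertex T | T <- enum (finset tri)].
  by rewrite -fan_face0; apply: fan_face_neq0.
move=> k hP w /fan_polytope_vertexP[T tT ->].
have {hP} -> : k = \dim {:V} by exact: has_dim_uniq hP fan_polytope_dim.
have [e ekE] : exists e : 'I_(\dim {:V}) -> I, injective e /\
    forall D, D \in T <-> exists i, D = e i.
  exists (fun i => enum_val (cast_ord (esym (tri_card tT)) i)); split.
    by move=> i j /enum_val_inj/cast_ord_inj.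
  move=> D; split=> [DT|[i ->]]; last exact: enum_valP.
  exists (cast_ord (tri_card tT) (enum_rank_in DT D)).
  by rewrite cast_ordK enum_rankK_in.
have [e_inj eT] := ekE.
have nce i : nc (finset.set1 (e i)).
  apply: ncS (tri_nc tT); rewrite finset.sub1set; apply/eT; by exists i.
have -> : [set F | facet fan_polytope F /\ F (tri_vertex T)] =
    (fun i => fan_face (finset.set1 (e i))) @` [set: 'I_(\dim {:V})].
  rewrite predeqE => F; split=> [[/fan_polytope_facetP[D ncD ->] [_ TD]]|[i _ <-]].
    have : D \in T by rewrite -tri_vertex_eq // TD // inE.
    by move=> /eT[i ->]; exists i.
  split; first by apply/fan_polytope_facetP; exists (e i).
  by apply: fan_face_vertex => //; rewrite finset.sub1set; apply/eT; exists i.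
apply: card_eq_trans; first apply: inj_card_eq.
  by move=> i j _ _ /(fan_face_inj (nce i) (nce j))/finset.set1_inj/e_inj.
by rewrite card_eq_sym; apply: card_II.
Qed.

Local Notation nc_cone A := (cone [seq v D | D <- enum A]).

Lemma nc_cone_sum A (a : I -> R) : (forall D, D \in A -> 0 <= a D) ->
  nc_cone A (\sum_(D in A) a D *: v D).
Proof. by move=> a0; apply/cone_familyP; exists a. Qed.

Lemma nc_coneS A B : A \subset B -> nc_cone A `<=` nc_cone B.
Proof.
move=> /fintype.subsetP AB u /cone_familyP[a a0 ->].
apply/cone_familyP; exists (fun D => if D \in A then a D else 0).
  by move=> D _; case: ifP => // /a0.
rewrite [RHS](big_setID A) /= [X in _ = _ + X]big1 ?addr0 => [|D].
  rewrite (_ : B :&: A = A); first by apply: eq_bigr => D ->.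
  by apply/finset.setIidPr/fintype.subsetP.
by rewrite inE => /andP[/negPf-> _]; rewrite scale0r.
Qed.

Lemma positive_support_sub A B (a b : I -> R) : nc A -> nc B ->
  (forall D, D \in A -> 0 < a D) -> (forall D, D \in B -> 0 < b D) ->
  \sum_(D in A) a D *: v D = \sum_(D in B) b D *: v D -> A \subset B.
Proof.
move=> ncA ncB a0 b0 ab; apply/(fan_face_sub _ ncB) => p pB.
have [q qA] := fan_face_neq0 ncA.
apply/(form_comb_eq a0 pB.1)/le_anti; rewrite form_comb_le //=; last by case: pB.
rewrite -(form_comb_eq a0 qA.1).2 // ab (form_comb_eq b0 pB.1).2 //.
by apply: form_comb_le => //; case: qA.
Qed.

Lemma nc_cone_cap A B : nc A -> nc B -> nc_cone A `&` nc_cone B = nc_cone (A :&: B).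
Proof.
move=> ncA ncB; rewrite predeqE => u; split=> [[uA uB]|uAB]; last first.
  by split; apply: nc_coneS uAB; rewrite ?finset.subsetIl ?finset.subsetIr.
have [A' [A'A ncA' [a a0 ua]]] := nc_conep uA ncA.
have [B' [B'B ncB' [b b0 ub]]] := nc_conep uB ncB.
have A'B' : A' \subset B' by apply: positive_support_sub ncA' ncB' a0 b0 _; rewrite -ua.
apply: (@nc_coneS A'); first by rewrite finset.subsetI A'A (fintype.subset_trans A'B').
by rewrite ua; apply: nc_cone_sum => D /a0/ltW.
Qed.

Lemma nc_cone_sub A B : nc A -> nc B -> nc_cone A `<=` nc_cone B <-> A \subset B.
Proof.
move=> ncA ncB; split=> [AB|]; last exact: nc_coneS.
have [B' [B'B ncB' [b b0 ub]]] : exists B', [/\ B' \subset B, nc B' & exists2 b : I -> R,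
     (forall D, D \in B' -> 0 < b D) & \sum_(D in A) 1 *: v D = \sum_(D in B') b D *: v D].
  by apply: nc_conep => //; apply: AB; apply: nc_cone_sum.
apply: fintype.subset_trans B'B.
by apply: positive_support_sub ncA ncB' (fun _ _ => ltr01) b0 ub.
Qed.

Lemma nc_cone_faceP A C : nc A ->
  face (nc_cone A) C <-> exists2 B : {set I}, B \subset A & C = nc_cone B.
Proof.
move=> ncA; split=> [[[w Cw] [f [b [f_le CE]]]]|[B BA ->]].
  have b0 : b = 0.
    apply/le_anti/andP; split; last first.
      have := f_le 0; rewrite linear0; apply; apply/cone_familyP.
      by exists (fun=> 0) => //; rewrite big1 // => D _; rewrite scale0r.
    move: Cw; rewrite CE => -[/cone_familyP[a a0 wE] fw].
    have : (f (w + w) : R) <= b.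
      apply: f_le; apply/cone_familyP; exists (fun D => a D + a D).
        by move=> D DA; rewrite addr_ge0 ?a0.
      by rewrite wE -big_split; apply: eq_bigr => D _; rewrite scalerDl.
    by rewrite form_add fw gerDl.
  subst b; pose B := [set D in A | (f (v D) : R) == 0].
  have BA : B \subset A by apply/fintype.subsetP => D; rewrite inE => /andP[].
  have f_le0 D : D \in A -> (f (v D) : R) <= 0.
    move=> DA; apply: f_le; apply/cone_familyP; exists (fun E => (E == D)%:R) => //.
    rewrite (bigD1 D) //= eqxx scale1r big1 ?addr0 // => E /andP[_ /negPf->].
    by rewrite scale0r.
  exists B => //; rewrite CE predeqE => u; split=> [[/cone_familyP[a a0 uE] fu]|uB].
    apply/cone_familyP; exists a => [D /(fintype.subsetP BA)|]; first exact: a0.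
    rewrite uE (big_setID B) /= [X in _ + X]big1 ?addr0 => [|D].
      by apply: eq_bigl => D; rewrite !inE; case: (D \in A).
    rewrite !inE => /andP[DB DA]; rewrite DA /= in DB.
    have aD : a D * (f (v D) : R) = 0.
      have nonpos E : E \in A -> a E * (f (v E) : R) <= 0.
        by move=> EA; rewrite mulr_ge0_le0 ?a0 ?f_le0.
      apply/le_anti; rewrite nonpos //= -{1}fu uE form_sum (bigD1 D) //= form_scale gerDl.
      by apply: sumr_le0 => E /andP[EA _]; rewrite form_scale nonpos.
    by move/eqP: aD; rewrite mulf_eq0 (negPf DB) orbF => /eqP->; rewrite scale0r.
  split; first exact: nc_coneS uB.
  case/cone_familyP: uB => a a0 ->; rewrite form_sum big1 // => D.
  by rewrite inE form_scale => /andP[_ /eqP->]; rewrite mulr0.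
split; first by exists (\sum_(D in B) 0 *: v D); apply: nc_cone_sum.
have [f fE] := nc_form (fun D => - (D \notin B)%:R) ncA.
have f_comb (a : I -> R) : (f (\sum_(D in A) a D *: v D) : R) =
    - \sum_(D in A :\: B) a D.
  rewrite form_sum (big_setID B) /= [X in X + _]big1 ?add0r => [|D].
    rewrite -sumrN; apply: eq_bigr => D; rewrite inE => /andP[DB DA].
    by rewrite form_scale fE // DB mulrN1.
  by rewrite inE => /andP[DA DB]; rewrite form_scale fE // DB oppr0 mulr0.
exists f, 0; split=> [u /cone_familyP[a a0 ->]|].
  rewrite f_comb oppr_le0 sumr_ge0 // => D.
  by rewrite inE => /andP[_ /a0].
rewrite predeqE => u; split=> [uB|[/cone_familyP[a a0 uE]]].
  split; first exact: nc_coneS uB.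
  case/cone_familyP: uB => a a0 ->; rewrite form_sum big1 // => D DB.
  by rewrite form_scale fE ?(fintype.subsetP BA) // DB oppr0 mulr0.
rewrite uE f_comb => /eqP; rewrite oppr_eq0 psumr_eq0 => [/allP z|D]; last first.
  by rewrite inE => /andP[_ /a0].
rewrite (big_setID B) /= [X in _ + X]big1 ?addr0 => [|D DAB].
  rewrite (_ : A :&: B = B); last by apply/finset.setIidPr.
  by apply: nc_cone_sum => D /(fintype.subsetP BA)/a0.
by have := z D; rewrite mem_index_enum DAB => /(_ isT)/eqP->; rewrite scale0r.
Qed.

Definition nc_fan : set (set V) := [set C | exists2 A, nc A & C = nc_cone A].

Lemma nc_fanP : nc_fan = [set C | exists2 T, tri T & face (nc_cone T) C].
Proof.
rewrite predeqE => C; split=> [[A ncA ->]|[T tT]].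
  have [T AT tT] := nc_extend ncA; exists T => //.
  by apply/nc_cone_faceP; [exact: tri_nc|exists A].
move=> /nc_cone_faceP-/(_ (tri_nc tT))[B BT ->].
by exists B => //; apply: ncS (tri_nc tT).
Qed.

Lemma nc_fan_complete : complete_fan nc_fan.
Proof.
split; last first.
  rewrite predeqE => u; split=> // _; have [A ncA [a a0 ->]] := nc_complete u.
  by exists (nc_cone A); [exists A|apply: nc_cone_sum => D /a0/ltW].
split.
- apply: (@sub_finite_set _ _ ((fun A => nc_cone A) @` [set: {set I}])).
    by move=> C [A _ ->]; exists A.
  exact/finite_image/finite_finset.
- by move=> C [A _ ->]; exists [seq v D | D <- enum A].
- move=> C D [A ncA ->] /(nc_cone_faceP _ ncA)[B BA ->].
  by exists B => //; apply: ncS ncA.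
- move=> C D [A ncA ->] [B ncB ->]; rewrite nc_cone_cap //.
  by split; apply/nc_cone_faceP => //; exists (A :&: B); rewrite ?finset.subsetIl ?finset.subsetIr.
Qed.

Lemma nc_fan_simplicial : simplicial nc_fan.
Proof. by move=> C [A ncA ->]; exists [seq v D | D <- enum A]; rewrite ?nc_free. Qed.

Lemma nc_fan_maximal : maximal_cones nc_fan = [set nc_cone T | T in [set T | tri T]].
Proof.
rewrite predeqE => C; split=> [[[A ncA ->] maxA]|[T tT <-]].
  have [T AT tT] := nc_extend ncA; exists T => //.
  by apply: maxA; [exists T; rewrite ?tri_nc|exact: nc_coneS].
split; first by exists T; rewrite ?tri_nc.
move=> D [B ncB ->] /nc_cone_sub TB.
by rewrite (tri_max tT ncB) //; apply: TB => //; apply: tri_nc.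
Qed.

End PolytopalFan.

(** * The fan of a seed triangulation *)

Section SeedTriangulations.
Variables (R : realType) (n : nat) (delta : 'I_n -> polygon_diagonal n).
Variables (V : vectType R) (alpha : n.-tuple V).
Hypothesis delta_inj : injective delta.
Hypothesis delta_nc : forall i j, ~~ crossb (delta i) (delta j).
Hypothesis alpha_basis : basis_of fullv alpha.
Implicit Types (D E F K : polygon_diagonal n) (A T : {set polygon_diagonal n}).

Local Notation vec := (seed_vec delta alpha).
Local Notation height := (seed_height R delta).

Let dimV : \dim {:V} = n. Proof. exact: size_basis alpha_basis. Qed.

Let vec_positive := seed_vec_positive delta_inj delta_nc alpha_basis.

Definition seed_vertex T : Prop :=
  <<[seq vec D | D <- enum T]>>%VS = fullv /\
  exists2 f, admissible vec height f & T \subset active vec height f.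

Lemma seed_vertex_seed T : (forall D, D \in T <-> exists i, D = delta i) ->
  seed_vertex T.
Proof.
move=> TE; have deltaT i : delta i \in T by apply/TE; exists i.
split.
  apply/eqP; rewrite eqEsubv subvf /= -(span_basis alpha_basis).
  apply/span_subvP => w /(nthP 0)[i]; rewrite size_tuple => ilt <-.
  rewrite -[_`_i]opprK -(seed_vec_delta alpha delta_inj delta_nc (Ordinal ilt)) memvN.
  by apply/memv_span/map_f; rewrite mem_enum.
pose f : 'Hom(V, R^o) :=
  \sum_(i < n) (- height (delta i)) *: linfun (coord alpha i : V -> R^o).
have fE (j : 'I_n) : (f alpha`_j : R) = - height (delta j).
  rewrite sumf_form (bigD1 j) //= scalef_form lfunE /= coord_free ?(basis_free alpha_basis) //.
  rewrite eqxx mulr1 big1 ?addr0 // => i ij.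
  rewrite scalef_form lfunE /= coord_free ?(basis_free alpha_basis) //.
  by rewrite eq_sym (negPf ij) mulr0.
have fdelta i : (f (vec (delta i)) : R) = height (delta i).
  by rewrite seed_vec_delta // -scaleN1r form_scale fE mulN1r opprK.
exists f => [D|]; last first.
  by apply/fintype.subsetP => D /TE[i ->]; rewrite inE fdelta.
have [/existsP[i /eqP ->]|D0] := boolP (in_seed delta D); first by rewrite fdelta.
rewrite seed_vec_notin //; apply: (@le_trans _ _ 0); last exact/ltW/seed_height_gt0.
rewrite form_sum; apply: sumr_le0 => i _; rewrite form_scale fE mulrN oppr_le0.
by rewrite mulr_ge0 ?ler0n // ltW // seed_height_gt0.
Qed.

Lemma seed_vertex_flip T a b c d D E : maxnc T -> (a < b < c)%N -> (c < d)%N ->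
  quad T a b c d -> chords_of a b c d D E -> D \in T -> seed_vertex T ->
  seed_vertex (E |: T :\ D).
Proof.
move=> mT abc cd qT chDE DT [spanT [f admf /fintype.subsetP Tf]].
have [mT' [e1 e2 e3 e4] ET cT'] := flip_maxnc mT abc cd qT chDE DT.
have [ncT maxT] := mT.
have dn : (d < n.+3)%N by case: e4.
split.
  set T' := E |: T :\ D in e1 e2 e3 e4 *.
  have vT' K : K \in T' -> vec K \in <<[seq vec K | K <- enum T']>>%VS.
    by move=> KT'; apply/memv_span/map_f; rewrite mem_enum.
  have cT u w : edge T' u w -> cross_vec delta alpha u w \in <<[seq vec K | K <- enum T']>>%VS.
    by move=> /(cross_vec_edge alpha delta_nc)[->|[K KT' [_ [_ ->]]]]; rewrite ?mem0v ?vT'.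
  apply/eqP; rewrite eqEsubv subvf /= -spanT; apply/span_subvP => w /mapP[K].
  rewrite mem_enum => KT ->; have [->|KD] := eqVneq K D; last first.
    by apply: vT'; rewrite !inE KD KT orbT.
  have [l [m [k1 [k2 [k3 [k4 [[l0 m0] _ e _]]]]]]] :=
    seed_vec_relation alpha delta_nc abc cd dn chDE.
  have -> : vec D = l^-1 *: (k1 *: cross_vec delta alpha a b + k2 *: cross_vec delta alpha b c
      + k3 *: cross_vec delta alpha c d + k4 *: cross_vec delta alpha a d - m *: vec E).
    by rewrite -e addrK scalerA mulVf ?scale1r ?lt0r_neq0.
  apply/memvZ/memvB; last by apply/memvZ/vT'; rewrite setU11.
  by rewrite !memvD ?memvZ ?cT.
have freeT : free [seq vec D | D <- enum T].
  by rewrite /free spanT size_map -cardE (maxnc_card mT) dimV.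
have [g gE] := free_form (fun K => - (K == D)%:R) freeT.
have gD : (g (vec D) : R) = -1 by rewrite gE // eqxx.
have g0 : g != 0.
  apply/eqP => g0; move: gD; rewrite g0 zero_lfunE => /esym/eqP.
  by rewrite oppr_eq0 oner_eq0.
have [t [F [t0 gF admf' actF]]] := walk vec_positive admf g0.
exists (f + t *: g) => //.
have actT K : K \in T -> K != D -> K \in active vec height (f + t *: g).
  move=> KT KD; have := Tf K KT; rewrite !inE addf_form scalef_form gE //.
  by rewrite (negPf KD) oppr0 mulr0 addr0.
have /ncbP nc' := admissible_active_ncb delta_nc admf'.
have FT : F \notin T.
  by apply: contraTN gF => FT; rewrite gE // -leNgt oppr_le0 ler0n.
have DF : crossb D F.
  apply: contraNT FT => DF; apply: maxT => K KT; have [->|KD] := eqVneq K D.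
    by rewrite crossbC.
  by apply: nc' => //; apply: actT.
have gn u w : edge T u w -> ~ (fst_end D = u /\ snd_end D = w) ->
    ~~ crossn u w (fst_end F) (snd_end F).
  case=> uw wn hK nD; have [/hK[K KT [Ku Kw]]|dn'] := boolP (diagn n u w); last first.
    by apply: side_crossn dn'; rewrite uw.
  rewrite -Ku -Kw; apply: nc' => //; apply: actT => //.
  by apply/eqP => KD; apply: nD; rewrite -KD.
have FE : F = E.
  have [q1 q2 q3 q4] := qT.
  by apply: (quad_only abc cd chDE _ _ _ _ DF); apply: gn => //;
    case: chDE => -[[-> ->] _]; move: abc cd; clear=> *; lia.
apply/fintype.subsetP => K; rewrite !inE => /orP[/eqP->|/andP[KD KT]].
  by move: actF; rewrite FE inE.
by have := actT K KT KD; rewrite inE.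
Qed.

Variable T0 : {set polygon_diagonal n}.
Hypothesis T0_card : #|T0| = n.
Hypothesis T0E : forall D, D \in T0 <-> exists i, D = delta i.

Lemma maxnc_seed_vertex T : maxnc T -> seed_vertex T.
Proof.
apply: (flip_ind _ _ (seed_vertex_seed T0E)); first exact: seed_vertex_flip.
apply: maxnc_ncb => //; apply/ncbP => D E /T0E[i ->] /T0E[j ->].
exact: delta_nc.
Qed.

Local Notation tri := (tri V (@ncb n)).

Lemma triE T : tri T <-> maxnc T.
Proof.
split=> [/andP[ncT /eqP cT]|mT]; first by apply: maxnc_ncb; rewrite ?cT.
by rewrite /tri; have [-> _] := mT; rewrite maxnc_card // dimV eqxx.
Qed.

Lemma ncb0 : @ncb n finset.set0.
Proof. by apply/ncbP => D E; rewrite inE. Qed.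

Lemma ncb_tri A : ncb A -> exists2 T : {set polygon_diagonal n}, A \subset T & tri T.
Proof. by move=> /ncb_extend[T AT mT]; exists T => //; apply/triE. Qed.

Lemma tri_spanning T : tri T -> <<[seq vec D | D <- enum T]>>%VS = fullv.
Proof. by move=> /triE/maxnc_seed_vertex[]. Qed.

Lemma tri_active T : tri T ->
  exists2 f, admissible vec height f & T \subset active vec height f.
Proof. by move=> /triE/maxnc_seed_vertex[]. Qed.

End SeedTriangulations.

Section Polygon.
Variables (R : realType) (n : nat) (x : 'I_n.+3 -> 'rV[R]_2).
Hypothesis x_convex : convex_polygon x.

Lemma noncrossingP (A : {set polygon_diagonal n}) : noncrossing x A <-> ncb A.
Proof.
split=> [ncA|/ncbP ncA D E DA EA /(crossesP x_convex)]; last exact/negP/ncA.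
by apply/ncbP => D E DA EA; apply/negP => /(crossesP x_convex); apply: ncA.
Qed.

End Polygon.

Theorem theorem5p2 (R : realType) (n : nat)
  (x : 'I_n.+3 -> 'rV[R]_2) (x_convex : convex_polygon x)
  (T0 : {set polygon_diagonal n}) (T0_triang : triangulation x T0)
  (delta : 'I_n -> polygon_diagonal n) (delta_inj : injective delta)
  (T0E : forall D, D \in T0 <-> exists i, D = delta i)
  (V : vectType R) (alpha : n.-tuple V) (alpha_basis : basis_of fullv alpha) :
  [/\ complete_fan (seed_fan x delta alpha),
      simplicial (seed_fan x delta alpha),
      maximal_cones (seed_fan x delta alpha)
        = [set triangulation_cone x delta alpha T | T in triangulation x]
    & exists P : set 'Hom(V, R^o),
        associahedron x P /\ normal_fan P = seed_fan x delta alpha].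
Proof.
have [nc_T0 T0_card] := T0_triang.
have delta_nc i j : ~~ crossb (delta i) (delta j).
  by apply/negP => /(crossesP x_convex); apply: nc_T0; apply/T0E; [exists i|exists j].
have dimV : \dim {:V} = n by exact: size_basis alpha_basis.
pose v := seed_vec delta alpha; pose h := seed_height R delta.
have v_pos := seed_vec_positive delta_inj delta_nc alpha_basis.
have nc_act f : admissible v h f -> ncb (active v h f).
  exact: admissible_active_ncb.
have nc0 := @ncb0 n; have ncS := @ncbS n; have nc_ext := ncb_tri alpha_basis.
have spanT := tri_spanning delta_inj delta_nc alpha_basis T0_card T0E.
have admT := tri_active delta_inj delta_nc alpha_basis T0_card T0E.
have coneE T : triangulation_cone x delta alpha T = cone [seq v D | D <- enum T].
  rewrite /triangulation_cone; congr cone; apply: eq_map.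
  exact: diag_vectorE.
have triP T : triangulation x T <-> tri V (@ncb n) T.
  split=> [[/(noncrossingP x_convex) ncT cT]|/andP[ncT /eqP cT]].
    by rewrite /tri ncT cT dimV eqxx.
  by split; [apply/(noncrossingP x_convex)|rewrite cT].
have fanE : seed_fan x delta alpha = nc_fan v (@ncb n).
  rewrite (nc_fanP ncS nc_ext spanT) predeqE => C.
  by split=> -[T /triP tT]; rewrite ?coneE => TC; exists T; rewrite ?coneE.
rewrite fanE; split.
- exact: (nc_fan_complete v_pos nc0 ncS nc_act nc_ext spanT admT).
- exact: (nc_fan_simplicial nc_ext spanT).
- rewrite (nc_fan_maximal v_pos ncS nc_act nc_ext spanT admT).
  by rewrite predeqE => C; split=> -[T /triP tT <-]; exists T; rewrite ?coneE.
exists (fan_polytope v h (@ncb n)); split; last first.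
  exact: (fan_normal_fan v_pos nc0 ncS nc_act nc_ext spanT admT).
split.
- exact: (fan_polytope_simple v_pos nc0 ncS nc_act nc_ext spanT admT).
- have := fan_polytope_dim v_pos nc0 nc_act nc_ext spanT admT.
  by rewrite dimV.
have faceP := fan_polytope_faceP v_pos nc0 ncS nc_act nc_ext spanT admT.
exists (fan_face v h (@ncb n)).
  split=> [A /(noncrossingP x_convex) ncA|A B|F /faceP[A ncA ->]].
  - by apply/faceP; exists A.
  - rewrite !inE => /(noncrossingP x_convex) ncA /(noncrossingP x_convex) ncB.
    exact: (fan_face_inj v_pos nc_act nc_ext spanT admT).
  - by exists A => //; apply/(noncrossingP x_convex).
move=> A B /(noncrossingP x_convex) ncA _.
exact: (fan_face_sub v_pos nc_act nc_ext spanT admT).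
Qed.
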